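(* Let $X$ be a finite (nonempty) connected graph acted on by a finite group $G$. Let $X^G$ be the subgraph of vertices and edges fixed by $G$, with vertex set $V(X^G)$. Then the map $$h: V(X^G)\longrightarrow \mathrm{Sec}\left(\widehat{\Pi}_1(X),G\right),$$ which associates with each $G$-fixed vertex its conjugacy class of sections, is surjective and induces a bijection $$h:\pi_0\left(X^G\right)\longrightarrow \mathrm{Sec}\left(\widehat{\Pi}_1(X),G\right),$$ where $\pi_0$ of a graph denotes its set of connected components.
   Context: Graphs. A graph $X=(X_0,X_1,s,t)$ consists of a set $X_0$ of vertices, a set $X_1$ of edges and maps $s,t:X_1\to X_0$ (source and target); edges are thus directed, and loops and multiple edges are allowed. Maps of graphs, in particular group actions on graphs, respect $s$ and $t$. A map $f:Y\to X$ is a graph covering if for each edge $e\in X_1$ and each vertex $v\in Y_0$ with $f(v)=s(e)$ (resp. $f(v)=t(e)$) there is a unique edge $\widetilde e\in Y_1$ with $f(\widetilde e)=e$ and $s(\widetilde e)=v$ (resp. $t(\widetilde e)=v$). It is finite if the preimage of each vertex is finite. $\mathcal{E}(X)$ is the category of finite graph coverings $Y\to X$, with morphisms the maps over $X$. Pro-finite fundamental groupoid. For a vertex $v$ of $X$ let $F_v:\mathcal{E}(X)\to\mathrm{Set}$ be the fiber functor sending $p:Y\to X$ to the set $p^{-1}(v)$ of vertices over $v$. The pro-finite groupoid $\widehat{\Pi}_1(X)$ has the vertices of $X$ as objects, and $\widehat{\Pi}_1(X)(v,w)$ is the set of natural isomorphisms $F_v\to F_w$, with its natural pro-finite topology (a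 neighborhood basis of $\alpha$ is given by the sets $\{\beta:\beta_p=\alpha_p\}$, $p\in\mathcal{E}(X)$). Write $\widehat{\Pi}_1(X,v)=\widehat{\Pi}_1(X)(v,v)$. If $G$ acts on $X$, then $G$ acts on $\widehat{\Pi}_1(X)$: on objects by $v\mapsto g(v)$, and on morphisms $\alpha:F_v\to F_w$ by $(g(\alpha))_q=\alpha_{g^{-1}\circ q}$ for $q\in\mathcal{E}(X)$, using $q^{-1}(g(v))=(g^{-1}\circ q)^{-1}(v)$. Grothendieck exact sequence. For a group $\Gamma$ acting on a groupoid $\Pi$, the groupoid $Q(\Pi,\Gamma)$ has the objects of $\Pi$ as objects; morphisms $x\to y$ are pairs $(\sigma,\alpha)$ with $\sigma\in\Gamma$ and $\alpha:\sigma(x)\to y$ a morphism of $\Pi$; composition is $(\sigma,\alpha)\circ(\tau,\beta)=(\sigma\tau,\alpha\circ\sigma(\beta))$. Put $Q(\Pi,\Gamma,x)=Q(\Pi,\Gamma)(x,x)$. If $\Pi$ is connected there is a short exact sequence $$1\to\Pi(x,x)\to Q(\Pi,\Gamma,x)\to\Gamma\to1,\qquad (\sigma,\alpha)\mapsto\sigma.$$ $\mathrm{Sec}(\Pi,\Gamma)$ is the set of sections (homomorphisms $\Gamma\to Q(\Pi,\Gamma,x)$ splitting the surjection) modulo conjugation by elements of $\Pi(x,x)$. For a $\Gamma$-fixed object $y$ of $\Pi$, choose an isomorphism $\varphi:x\to y$ in $\Pi$; then $s_\varphi(\sigma)=(\sigma,\varphi^{-1}\circ\sigma(\varphi))$ is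 a section whose conjugacy class does not depend on $\varphi$; this class is $h(y)$. Here this is applied to $\Pi=\widehat{\Pi}_1(X)$, $\Gamma=G$, with any base vertex $x=v$ of $X$. *)

(* Defs.v *)
From HB Require Import structures.
From mathcomp Require Import all_boot all_fingroup.
From mathcomp Require Import boolp classical_sets functions cardinality.
From Stdlib Require Import Relations.

Set Implicit Arguments.
Unset Strict Implicit.
Unset Printing Implicit Defensive.

Local Open Scope group_scope.
Local Open Scope classical_set_scope.

Definition eq_quotient (T : Type) (R : T -> T -> Prop) : Type :=
  {C : set T | exists a, C = [set b | R a b]}.

Definition eq_class (T : Type) (R : T -> T -> Prop) (a : T) :
    eq_quotient R :=
  exist _ [set b | R a b] (ex_intro _ a erefl).

Lemma eq_classE (T : Type) (R : T -> T -> Prop) :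
  (forall a, R a a) -> (forall a b, R a b -> R b a) ->
  (forall a b c, R a b -> R b c -> R a c) ->
  forall a b, eq_class R a = eq_class R b <-> R a b.
Proof.
move=> rfl sym trs a b; split=> [[E]|ab].
  have : [set c | R b c] b by exact: rfl.
  by rewrite -E.
apply: eq_exist; apply/seteqP; split=> c /=; last exact: trs.
exact/trs/sym.
Qed.

(** [gcomp a b] is the composite "a after b". *)
Record groupoid := Groupoid {
  gobj : Type;
  ghom : gobj -> gobj -> Type;
  gid : forall x, ghom x x;
  gcomp : forall x y z, ghom y z -> ghom x y -> ghom x z;
  ginv : forall x y, ghom x y -> ghom y x;
  gcompA : forall x y z w (a : ghom z w) (b : ghom y z) (c : ghom x y),
    gcomp a (gcomp b c) = gcomp (gcomp a b) c;
  gcomp1g : forall x y (a : ghom x y), gcomp (gid y) a = a;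
  gcompg1 : forall x y (a : ghom x y), gcomp a (gid x) = a;
  gcompVg : forall x y (a : ghom x y), gcomp (ginv a) a = gid x;
  gcompgV : forall x y (a : ghom x y), gcomp a (ginv a) = gid y
}.

Arguments gid {g} x : rename.
Arguments gcomp {g x y z} a b : rename.
Arguments ginv {g x y} a : rename.

Declare Scope groupoid_scope.
Notation "a \c b" := (gcomp a b)
  (at level 40, left associativity, format "a  \c  b") : groupoid_scope.
Local Open Scope groupoid_scope.

Definition groupoid_connected (Pi : groupoid) : Prop :=
  forall x y : gobj Pi, inhabited (ghom x y).

(** The identity morphism, with its type adjusted along an equality of
    objects; it replaces transports of morphisms along such equalities. *)
Definition eqhom (Pi : groupoid) (x y : gobj Pi) (e : x = y) : ghom x y :=
  match e in _ = z return ghom x z with erefl => gid x end.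

Section GroupoidTheory.
Variable Pi : groupoid.
Implicit Types x y z : gobj Pi.

Lemma eqhom_id x (e : x = x) : eqhom e = gid x.
Proof. by rewrite (Prop_irrelevance e erefl). Qed.

Lemma eqhom_irr x y (e e' : x = y) : eqhom e = eqhom e'.
Proof. by rewrite (Prop_irrelevance e e'). Qed.

Lemma eqhom_comp x y z (e : y = z) (f : x = y) :
  eqhom e \c eqhom f = eqhom (etrans f e).
Proof. by case: z / e; rewrite gcomp1g. Qed.

Lemma eqhomK x y z (e : x = y) (e' : y = x) (a : ghom z y) :
  eqhom e \c (eqhom e' \c a) = a.
Proof. by rewrite gcompA eqhom_comp eqhom_id gcomp1g. Qed.

Lemma gcompK x y z (a : ghom y z) (b : ghom x y) : ginv a \c (a \c b) = b.
Proof. by rewrite gcompA gcompVg gcomp1g. Qed.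

Lemma gcompVK x y z (a : ghom z y) (b : ghom x y) : a \c (ginv a \c b) = b.
Proof. by rewrite gcompA gcompgV gcomp1g. Qed.

Lemma gcompI x y z (a : ghom y z) (b c : ghom x y) : a \c b = a \c c -> b = c.
Proof. by move=> E; rewrite -(gcompK a b) E gcompK. Qed.

Lemma ginv_uniq x y (a : ghom x y) (b : ghom y x) :
  a \c b = gid y -> b = ginv a.
Proof. by move=> E; apply: (@gcompI _ _ _ a); rewrite E gcompgV. Qed.

Lemma ginv_comp x y z (a : ghom y z) (b : ghom x y) :
  ginv (a \c b) = ginv b \c ginv a.
Proof. by apply/esym/ginv_uniq; rewrite -gcompA gcompVK gcompgV. Qed.

Lemma ginvK x y (a : ghom x y) : ginv (ginv a) = a.
Proof. by apply/esym/ginv_uniq; rewrite gcompVg. Qed.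

Lemma ginv_eqhom x y (e : x = y) : ginv (eqhom e) = eqhom (esym e).
Proof. by case: y / e => /=; apply/esym/ginv_uniq; rewrite gcomp1g. Qed.

End GroupoidTheory.

(** A strict left action by functors.  The last two axioms say that
    [1(a) = a] and [(st)(a) = s(t(a))]; the two sides of these equations have
    different (but equal) sources and targets, whence the [eqhom]s. *)
Record groupoid_action (Gam : groupType) (Pi : groupoid) := GroupoidAction {
  aobj : Gam -> gobj Pi -> gobj Pi;
  ahom : forall (s : Gam) (x y : gobj Pi),
    ghom x y -> ghom (aobj s x) (aobj s y);
  ahom_id : forall s x, ahom s (gid x) = gid (aobj s x);
  ahom_comp : forall s x y z (a : ghom y z) (b : ghom x y),
    ahom s (a \c b) = ahom s a \c ahom s b;
  aobj1 : forall x, aobj 1 x = x;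
  aobjM : forall s t x, aobj (s * t) x = aobj s (aobj t x);
  ahom1 : forall x y (a : ghom x y),
    eqhom (aobj1 y) \c ahom 1 a = a \c eqhom (aobj1 x);
  ahomM : forall s t x y (a : ghom x y),
    eqhom (aobjM s t y) \c ahom (s * t) a
    = ahom s (ahom t a) \c eqhom (aobjM s t x)
}.

Arguments ahom {Gam Pi} g s {x y} a : rename.
Arguments aobj {Gam Pi} g s x : rename.

Section Grothendieck.
Variables (Gam : groupType) (Pi : groupoid) (A : groupoid_action Gam Pi).
Implicit Types (s t : Gam) (x y z : gobj Pi).

Lemma ahom_eqhom s x y (e : x = y) :
  ahom A s (eqhom e) = eqhom (congr1 (aobj A s) e).
Proof. by case: y / e; rewrite /= ahom_id. Qed.

Lemma ahom_inv s x y (a : ghom x y) : ahom A s (ginv a) = ginv (ahom A s a).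
Proof. by apply: ginv_uniq; rewrite -ahom_comp gcompgV ahom_id. Qed.

Definition Qhom x y : Type := {s : Gam & ghom (aobj A s x) y}.

Definition Qid x : Qhom x x :=
  existT (fun s => ghom (aobj A s x) x) 1 (eqhom (aobj1 A x)).

(** (s, a) o (t, b) = (st, a o s(b)) *)
Definition Qcomp x y z (u : Qhom y z) (w : Qhom x y) : Qhom x z :=
  existT (fun s => ghom (aobj A s x) z) (tag u * tag w)
    (tagged u \c (ahom A (tag u) (tagged w)
                  \c eqhom (aobjM A (tag u) (tag w) x))).

Lemma Qinv_subproof s x : aobj A s^-1 (aobj A s x) = x.
Proof. by rewrite -aobjM mulVg aobj1. Qed.

Definition Qinv x y (u : Qhom x y) : Qhom y x :=
  existT (fun s => ghom (aobj A s y) x) (tag u)^-1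
    (eqhom (Qinv_subproof (tag u) x) \c ginv (ahom A (tag u)^-1 (tagged u))).

Lemma Qhom_eq x y (u w : Qhom x y) (e : tag u = tag w) :
  tagged u = tagged w \c eqhom (congr1 (fun s => aobj A s x) e) -> u = w.
Proof.
by case: u w e => [s a] [t b] /= e; case: t / e b => b /=; rewrite gcompg1 => ->.
Qed.

Lemma eqhom_ahom1 s (e1 : s = 1) x y (a : ghom x y) :
  ahom A s a = eqhom (esym (etrans (congr1 (aobj A ^~ y) e1) (aobj1 A y)))
    \c (a \c eqhom (etrans (congr1 (aobj A ^~ x) e1) (aobj1 A x))).
Proof.
subst s; apply: (@gcompI _ _ _ _ (eqhom (aobj1 A y))).
rewrite ahom1 [RHS]gcompA eqhom_comp eqhom_id gcomp1g.
by congr (_ \c _); exact: eqhom_irr.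
Qed.

Lemma ahomME s t x y (a : ghom x y) :
  ahom A (s * t) a
  = eqhom (esym (aobjM A s t y)) \c (ahom A s (ahom A t a)
                                      \c eqhom (aobjM A s t x)).
Proof. by rewrite -ahomM eqhomK. Qed.

Lemma QcompA x y z w (a : Qhom z w) (b : Qhom y z) (c : Qhom x y) :
  Qcomp a (Qcomp b c) = Qcomp (Qcomp a b) c.
Proof.
apply: Qhom_eq => [|e] /=; first exact: (mulgA _ _ _).
rewrite ahomME !ahom_comp ahom_eqhom -!gcompA !eqhom_comp.
by rewrite eqhomK; do 3!congr (_ \c _); exact: eqhom_irr.
Qed.

Lemma Qcomp1g x y (a : Qhom x y) : Qcomp (Qid y) a = a.
Proof.
apply: Qhom_eq => [|e] /=; first exact: (mul1g _).
rewrite gcompA ahom1 -gcompA eqhom_comp.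
by congr (_ \c _); exact: eqhom_irr.
Qed.

Lemma Qcompg1 x y (a : Qhom x y) : Qcomp a (Qid x) = a.
Proof.
apply: Qhom_eq => [|e] /=; first exact: (mulg1 _).
rewrite ahom_eqhom eqhom_comp.
by congr (_ \c _); exact: eqhom_irr.
Qed.

Lemma QcompVg x y (a : Qhom x y) : Qcomp (Qinv a) a = Qid x.
Proof.
apply: Qhom_eq => [|e] /=; first exact: (mulVg _).
rewrite -gcompA gcompK !eqhom_comp; exact: eqhom_irr.
Qed.

Lemma QcompgV x y (a : Qhom x y) : Qcomp a (Qinv a) = Qid y.
Proof.
rewrite -[LHS]Qcomp1g -(QcompVg (Qinv a)) -QcompA.
by rewrite [X in Qcomp _ X]QcompA QcompVg Qcomp1g.
Qed.

Definition Qgroupoid : groupoid :=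
  Groupoid QcompA Qcomp1g Qcompg1 QcompVg QcompgV.

(** The kernel inclusion [Pi(x, x) -> Q(Pi, Gam, x)]. *)
Definition Qker x (c : ghom x x) : @ghom Qgroupoid x x :=
  existT (fun s => ghom (aobj A s x) x) 1 (c \c eqhom (aobj1 A x)).

(** Sections of [Q(Pi, Gam, x) -> Gam] are plain homomorphisms: when [Gam] is
    finite, hence discrete, continuity is automatic. *)
Record Qsection (x : gobj Pi) := MkQsection {
  sec_fun :> Gam -> @ghom Qgroupoid x x;
  secM : forall s t, sec_fun (s * t) = sec_fun s \c sec_fun t;
  sec_split : forall s, tag (sec_fun s) = s
}.

Definition sec_conj x (f f' : Qsection x) : Prop :=
  exists c : ghom x x,
    forall s, f' s = Qker c \c f s \c ginv (Qker c).

Definition Sec x : Type := eq_quotient (@sec_conj x).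

Lemma QkerM x (c d : ghom x x) : Qker (c \c d) = Qker c \c Qker d.
Proof.
apply: Qhom_eq => [|e] /=; first exact: (esym (mulg1 _)).
rewrite ahom_comp (eqhom_ahom1 erefl) ahom_eqhom -!gcompA !eqhom_comp.
congr (_ \c _); rewrite [RHS]gcompA eqhom_comp eqhom_id gcomp1g.
by congr (_ \c _); exact: eqhom_irr.
Qed.

Lemma Qker1 x : Qker (gid x) = gid (x : gobj Qgroupoid).
Proof. by rewrite /Qker gcomp1g. Qed.

Lemma QkerV x (c : ghom x x) : Qker (ginv c) = ginv (Qker c).
Proof. by apply: ginv_uniq; rewrite -QkerM gcompgV Qker1. Qed.

Lemma sec_conj_refl x (f : Qsection x) : sec_conj f f.
Proof.
exists (gid x) => s.
by rewrite -QkerV Qker1 gcomp1g -(ginv_uniq (gcomp1g (gid x))) Qker1 gcompg1.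
Qed.

Lemma sec_conj_sym x (f g : Qsection x) : sec_conj f g -> sec_conj g f.
Proof.
move=> [c E]; exists (ginv c) => s.
by rewrite E QkerV ginvK -!gcompA gcompVg gcompg1 gcompK.
Qed.

Lemma sec_conj_trans x (f g k : Qsection x) :
  sec_conj f g -> sec_conj g k -> sec_conj f k.
Proof.
move=> [c E] [d F]; exists (d \c c) => s.
by rewrite F E QkerM ginv_comp -!gcompA.
Qed.

(** [s_phi : s |-> (s, phi^-1 o s(phi))] for a fixed object [y] *)
Definition is_fixed (y : gobj Pi) : Prop := forall s, aobj A s y = y.

Definition fixed_sec_fun x y (fy : is_fixed y) (phi : ghom x y) (s : Gam) :
    @ghom Qgroupoid x x :=
  existT (fun s => ghom (aobj A s x) x) s
    (ginv phi \c (eqhom (fy s) \c ahom A s phi)).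

Lemma fixed_sec_funM x y (fy : is_fixed y) (phi : ghom x y) s t :
  fixed_sec_fun fy phi (s * t) = fixed_sec_fun fy phi s \c fixed_sec_fun fy phi t.
Proof.
apply: Qhom_eq => /=.
rewrite gcompg1 !ahom_comp ahom_inv ahom_eqhom -!gcompA gcompVK -ahomM.
congr (_ \c _); rewrite !gcompA !eqhom_comp.
by congr (_ \c _); exact: eqhom_irr.
Qed.

Definition fixed_sec x y (fy : is_fixed y) (phi : ghom x y) : Qsection x :=
  MkQsection (fixed_sec_funM fy phi) (fun s => erefl).

Lemma fixed_sec_indep x y (fy : is_fixed y) (phi psi : ghom x y) :
  sec_conj (fixed_sec fy phi) (fixed_sec fy psi).
Proof.
exists (ginv psi \c phi) => s.
have E : fixed_sec fy psi s \c Qker (ginv psi \c phi)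
         = Qker (ginv psi \c phi) \c fixed_sec fy phi s.
  apply: Qhom_eq => [|e] /=; first exact: (etrans (mulg1 s) (esym (mul1g s))).
  rewrite (eqhom_ahom1 erefl) !ahom_comp ahom_inv ahom_eqhom -!gcompA.
  rewrite gcompVK eqhomK gcompVK !eqhom_comp.
  by do 3!congr (_ \c _); exact: eqhom_irr.
by rewrite -E -gcompA gcompgV gcompg1.
Qed.

(** The class [h(y)], for an arbitrary choice of [phi : x -> y]; by
    [fixed_sec_indep] it does not depend on this choice. *)
Definition sec_class (Pconn : groupoid_connected Pi) x y (fy : is_fixed y) :
    Sec x :=
  eq_class (@sec_conj x)
    (fixed_sec fy (inhabited_witness (Pconn x y))).

Lemma sec_classE (Pconn : groupoid_connected Pi) x y (fy : is_fixed y)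
    (phi : ghom x y) :
  sec_class Pconn x fy = eq_class (@sec_conj x) (fixed_sec fy phi).
Proof.
apply/eq_classE; last exact: fixed_sec_indep.
- exact: sec_conj_refl.
- exact: sec_conj_sym.
- exact: sec_conj_trans.
Qed.

End Grothendieck.

Record graph := Graph {
  gvert : Type;
  gedge : Type;
  gsrc : gedge -> gvert;
  gtgt : gedge -> gvert
}.

Definition finite_graph (X : graph) : Prop :=
  finite_set [set: gvert X] /\ finite_set [set: gedge X].

Definition adjacent (X : graph) (v w : gvert X) : Prop :=
  exists e : gedge X, gsrc e = v /\ gtgt e = w.

(** Joined by a path in which edges may be traversed in both directions. *)
Definition joined (X : graph) : gvert X -> gvert X -> Prop :=
  clos_refl_sym_trans (gvert X) (@adjacent X).

Definition connected_graph (X : graph) : Prop :=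
  inhabited (gvert X) /\ forall v w : gvert X, joined v w.

Definition pi0 (X : graph) : Type := eq_quotient (@joined X).

Definition component (X : graph) (v : gvert X) : pi0 X := eq_class (@joined X) v.

Record graph_map (Y X : graph) := GraphMap {
  mvert : gvert Y -> gvert X;
  medge : gedge Y -> gedge X;
  msrc : forall e, mvert (gsrc e) = gsrc (medge e);
  mtgt : forall e, mvert (gtgt e) = gtgt (medge e)
}.

Record graph_action (G : groupType) (X : graph) := GraphAction {
  actv : G -> gvert X -> gvert X;
  acte : G -> gedge X -> gedge X;
  act_src : forall g e, actv g (gsrc e) = gsrc (acte g e);
  act_tgt : forall g e, actv g (gtgt e) = gtgt (acte g e);
  actv1 : forall v, actv 1 v = v;
  acte1 : forall e, acte 1 e = e;
  actvM : forall g k v, actv (g * k) v = actv g (actv k v);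
  acteM : forall g k e, acte (g * k) e = acte g (acte k e)
}.

Section FixedGraph.
Variables (G : groupType) (X : graph) (A : graph_action G X).

Definition fixed_vert : Type := {v : gvert X | forall g, actv A g v = v}.
Definition fixed_edge : Type := {e : gedge X | forall g, acte A g e = e}.

Lemma fixed_src (e : fixed_edge) g : actv A g (gsrc (sval e)) = gsrc (sval e).
Proof. by rewrite act_src (svalP e). Qed.

Lemma fixed_tgt (e : fixed_edge) g : actv A g (gtgt (sval e)) = gtgt (sval e).
Proof. by rewrite act_tgt (svalP e). Qed.

Definition fixed_graph : graph :=
  @Graph fixed_vert fixed_edge
    (fun e => exist _ _ (fixed_src e)) (fun e => exist _ _ (fixed_tgt e)).

End FixedGraph.

Definition is_covering (Y X : graph) (f : graph_map Y X) : Prop :=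
  forall (e : gedge X) (v : gvert Y),
    (mvert f v = gsrc e -> exists! e', medge f e' = e /\ gsrc e' = v) /\
    (mvert f v = gtgt e -> exists! e', medge f e' = e /\ gtgt e' = v).

Definition is_finite_map (Y X : graph) (f : graph_map Y X) : Prop :=
  forall v : gvert X, finite_set (mvert f @^-1` [set v]).

Record fin_covering (X : graph) := FinCovering {
  cov_graph : graph;
  cov_map :> graph_map cov_graph X;
  cov_covering : is_covering cov_map;
  cov_finite : is_finite_map cov_map
}.

Record cov_hom (X : graph) (p q : fin_covering X) := CovHom {
  ch_map :> graph_map (cov_graph p) (cov_graph q);
  ch_vert : forall v, mvert q (mvert ch_map v) = mvert p v;
  ch_edge : forall e, medge q (medge ch_map e) = medge p e
}.

(** The fiber functor [F_v] on objects; [fiber_map] is its action on morphisms. *)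
Definition fiber (X : graph) (v : gvert X) (p : fin_covering X) : Type :=
  {y : gvert (cov_graph p) | mvert p y = v}.

Lemma fiber_map_subproof (X : graph) (v : gvert X) (p q : fin_covering X)
    (f : cov_hom p q) (y : fiber v p) : mvert q (mvert f (sval y)) = v.
Proof. by rewrite ch_vert (svalP y). Qed.

Definition fiber_map (X : graph) (v : gvert X) (p q : fin_covering X)
    (f : cov_hom p q) (y : fiber v p) : fiber v q :=
  exist _ (mvert f (sval y)) (fiber_map_subproof f y).

Lemma fiber_eq (X : graph) (v : gvert X) (p : fin_covering X)
    (y z : fiber v p) : sval y = sval z -> y = z.
Proof. by case: y z => [y yv] [z zv] /=; exact: eq_exist. Qed.

Record nat_iso (X : graph) (v w : gvert X) := NatIso {
  ni_fun :> forall p : fin_covering X, fiber v p -> fiber w p;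
  ni_inv : forall p : fin_covering X, fiber w p -> fiber v p;
  ni_funK : forall p, cancel (@ni_fun p) (@ni_inv p);
  ni_invK : forall p, cancel (@ni_inv p) (@ni_fun p);
  ni_nat : forall (p q : fin_covering X) (f : cov_hom p q) (y : fiber v p),
    @ni_fun q (fiber_map f y) = fiber_map f (@ni_fun p y)
}.

#[local] Obligation Tactic := idtac.

Section FundamentalGroupoid.
Variable X : graph.
Implicit Types (v w : gvert X) (p q : fin_covering X).

Lemma nat_iso_eq v w (a b : nat_iso v w) :
  (forall p y, sval (a p y) = sval (b p y)) -> a = b.
Proof.
case: a b => [f g fK gK n] [f' g' fK' gK' n'] /= E.
have {}E : f = f'.
  by apply: functional_extensionality_dep => p; apply/funext => y; exact/fiber_eq.
subst f'.
have E : g = g'.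
  apply: functional_extensionality_dep => p; apply/funext => y.
  by apply: (can_inj (fK p)); rewrite gK gK'.
subst g'.
by congr NatIso; exact: Prop_irrelevance.
Qed.

Program Definition nat_iso_id v : nat_iso v v :=
  @NatIso X v v (fun _ y => y) (fun _ y => y) _ _ _.
Solve All Obligations with by [].

Program Definition nat_iso_comp u v w (a : nat_iso v w) (b : nat_iso u v) :
    nat_iso u w :=
  @NatIso X u w (fun p y => a p (b p y)) (fun p y => ni_inv b (ni_inv a y))
    _ _ _.
Next Obligation. by move=> u v w a b p y; rewrite !ni_funK. Qed.
Next Obligation. by move=> u v w a b p y; rewrite !ni_invK. Qed.
Next Obligation. by move=> u v w a b p q f y /=; rewrite !ni_nat. Qed.

Program Definition nat_iso_inv v w (a : nat_iso v w) : nat_iso w v :=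
  @NatIso X w v (fun p => @ni_inv _ _ _ a p) (fun p => a p) _ _ _.
Next Obligation. by move=> v w a p; exact: ni_invK. Qed.
Next Obligation. by move=> v w a p; exact: ni_funK. Qed.
Next Obligation.
move=> v w a p q f y; apply: (can_inj (@ni_funK _ _ _ a q)).
by rewrite ni_nat !ni_invK.
Qed.

Program Definition Pi1 : groupoid :=
  @Groupoid (gvert X) (@nat_iso X) nat_iso_id nat_iso_comp nat_iso_inv
    _ _ _ _ _.
Next Obligation. by move=> *; exact: nat_iso_eq. Qed.
Next Obligation. by move=> *; exact: nat_iso_eq. Qed.
Next Obligation. by move=> *; exact: nat_iso_eq. Qed.
Next Obligation. by move=> x y a; apply: nat_iso_eq => p z /=; rewrite ni_funK. Qed.
Next Obligation. by move=> x y a; apply: nat_iso_eq => p z /=; rewrite ni_invK. Qed.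

Lemma Pi1_eqhomE v w (e : v = w) p (y : fiber v p) :
  sval ((eqhom (e : v = w :> gobj Pi1) : nat_iso v w) p y) = sval y.
Proof. by case: w / e. Qed.

Lemma nat_iso_sval v w (a : nat_iso v w) p (y z : fiber v p) :
  sval y = sval z -> sval (a p y) = sval (a p z).
Proof. by move=> /fiber_eq ->. Qed.

Lemma nat_iso_natE v w (a : nat_iso v w) p q (f : cov_hom p q)
    (y : fiber v p) (z : fiber v q) :
  mvert f (sval y) = sval z -> mvert f (sval (a p y)) = sval (a q z).
Proof.
move=> E; have -> : z = fiber_map f y by exact: fiber_eq.
by rewrite ni_nat.
Qed.

End FundamentalGroupoid.

Section Action.
Variables (G : groupType) (X : graph) (A : graph_action G X).
Implicit Types (g k : G) (v w : gvert X) (p q : fin_covering X).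

Lemma actvK g : cancel (actv A g) (actv A g^-1).
Proof. by move=> v; rewrite -actvM mulVg actv1. Qed.
Lemma actvKV g : cancel (actv A g^-1) (actv A g).
Proof. by move=> v; rewrite -actvM mulgV actv1. Qed.
Lemma acteK g : cancel (acte A g) (acte A g^-1).
Proof. by move=> e; rewrite -acteM mulVg acte1. Qed.
Lemma acteKV g : cancel (acte A g^-1) (acte A g).
Proof. by move=> e; rewrite -acteM mulgV acte1. Qed.

(** The composite [g o q]. *)
Definition twist_map g q : graph_map (cov_graph q) X.
Proof.
exists (fun y => actv A g (mvert q y)) (fun e => acte A g (medge q e)) => e.
- by rewrite msrc act_src.
- by rewrite mtgt act_tgt.
Defined.

Lemma twist_covering g q : is_covering (twist_map g q).
Proof.
move=> e v; have [cs ct] := @cov_covering X q (acte A g^-1 e) v.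
split=> /= /(congr1 (actv A g^-1)); rewrite actvK.
- rewrite act_src => /cs[e' [[E1 E2] U]]; exists e'; split.
    by rewrite E1 acteKV.
  by move=> e'' [F1 F2]; apply: U; rewrite -F1 acteK.
- rewrite act_tgt => /ct[e' [[E1 E2] U]]; exists e'; split.
    by rewrite E1 acteKV.
  by move=> e'' [F1 F2]; apply: U; rewrite -F1 acteK.
Qed.

Lemma twist_finite g q : is_finite_map (twist_map g q).
Proof.
move=> v; apply: sub_finite_set (@cov_finite X q (actv A g^-1 v)).
by move=> y /= <-; rewrite actvK.
Qed.

Definition twist g q : fin_covering X :=
  FinCovering (@twist_covering g q) (@twist_finite g q).

Definition twist_hom g p q (f : cov_hom p q) : cov_hom (twist g p) (twist g q).
Proof.
exists (f : graph_map (cov_graph (twist g p)) (cov_graph (twist g q))) => z /=.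
- by rewrite ch_vert.
- by rewrite ch_edge.
Defined.

(** [q^-1(g v) = (g^-1 o q)^-1(v)], in both directions. *)
Lemma to_twist_subproof g v q (y : fiber (actv A g v) q) :
  mvert (twist g^-1 q) (sval y) = v.
Proof. by rewrite /= (svalP y) actvK. Qed.

Definition to_twist g v q (y : fiber (actv A g v) q) : fiber v (twist g^-1 q) :=
  exist _ (sval y) (to_twist_subproof y).

Lemma of_twist_subproof g v q (y : fiber v (twist g^-1 q)) :
  mvert q (sval y) = actv A g v.
Proof. by case: y => y /= <-; rewrite actvKV. Qed.

Definition of_twist g v q (y : fiber v (twist g^-1 q)) : fiber (actv A g v) q :=
  exist _ (sval y) (of_twist_subproof y).

Lemma to_twistK g v q : cancel (@to_twist g v q) (@of_twist g v q).
Proof. by move=> y; exact: fiber_eq. Qed.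
Lemma of_twistK g v q : cancel (@of_twist g v q) (@to_twist g v q).
Proof. by move=> y; exact: fiber_eq. Qed.

(** [(g(a))_q = a_(g^-1 o q)] *)
Program Definition act_nat_iso g v w (a : nat_iso v w) :
    nat_iso (actv A g v) (actv A g w) :=
  @NatIso X _ _ (fun q y => of_twist (a (twist g^-1 q) (to_twist y)))
    (fun q y => of_twist (ni_inv a (to_twist y))) _ _ _.
Next Obligation. by move=> g v w a p y; rewrite of_twistK ni_funK to_twistK. Qed.
Next Obligation. by move=> g v w a p y; rewrite of_twistK ni_invK to_twistK. Qed.
Next Obligation.
move=> g v w a p q f y; apply: fiber_eq => /=.
by apply/esym/(nat_iso_natE a (f := twist_hom g^-1 f)).
Qed.

Definition twist1_hom q : cov_hom (twist 1^-1 q) q.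
Proof.
exists (@GraphMap (cov_graph (twist 1^-1 q)) (cov_graph q) id id
  (fun _ => erefl) (fun _ => erefl)) => z /=.
- by rewrite invg1 actv1.
- by rewrite invg1 acte1.
Defined.

Definition twistM_hom g k q :
  cov_hom (twist (g * k)^-1 q) (twist k^-1 (twist g^-1 q)).
Proof.
exists (@GraphMap (cov_graph (twist (g * k)^-1 q))
  (cov_graph (twist k^-1 (twist g^-1 q))) id id
  (fun _ => erefl) (fun _ => erefl)) => z /=.
- by rewrite invMg actvM.
- by rewrite invMg acteM.
Defined.

Program Definition Pi1_action : groupoid_action G (Pi1 X) :=
  @GroupoidAction G (Pi1 X) (actv A) act_nat_iso _ _ (actv1 A) (actvM A) _ _.
Next Obligation. by move=> g v; apply: nat_iso_eq. Qed.
Next Obligation.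
move=> g u v w a b; apply: nat_iso_eq => p y.
by rewrite /= of_twistK.
Qed.
Next Obligation.
move=> v w a; apply: nat_iso_eq => p y.
rewrite /= Pi1_eqhomE /=.
by apply: (nat_iso_natE a (f := twist1_hom p)); rewrite /= Pi1_eqhomE.
Qed.
Next Obligation.
move=> g k v w a; apply: nat_iso_eq => p y.
rewrite /= Pi1_eqhomE /=.
by apply: (nat_iso_natE a (f := twistM_hom g k p)); rewrite /= Pi1_eqhomE.
Qed.

End Action.

Section Connectedness.
Variable X : graph.
Implicit Types (p q : fin_covering X).

Section EdgeLift.
Variable e : gedge X.

Lemma lift_src p (y : fiber (gsrc e) p) :
  {e' | medge p e' = e /\ gsrc e' = sval y}.
Proof.
apply: cid; have [+ _] := @cov_covering X p e (sval y).
by move=> /(_ (svalP y))[e' [H _]]; exists e'.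
Qed.

Lemma lift_tgt p (y : fiber (gtgt e) p) :
  {e' | medge p e' = e /\ gtgt e' = sval y}.
Proof.
apply: cid; have [_ +] := @cov_covering X p e (sval y).
by move=> /(_ (svalP y))[e' [H _]]; exists e'.
Qed.

Lemma lift_src_uniq p (a b : gedge (cov_graph p)) :
  medge p a = e -> medge p b = e -> gsrc a = gsrc b -> a = b.
Proof.
move=> ea eb ab; have [+ _] := @cov_covering X p e (gsrc a).
by rewrite msrc ea => /(_ erefl)[c [_ U]]; rewrite -(U a) // -(U b).
Qed.

Lemma lift_tgt_uniq p (a b : gedge (cov_graph p)) :
  medge p a = e -> medge p b = e -> gtgt a = gtgt b -> a = b.
Proof.
move=> ea eb ab; have [_ +] := @cov_covering X p e (gtgt a).
by rewrite mtgt ea => /(_ erefl)[c [_ U]]; rewrite -(U a) // -(U b).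
Qed.

Lemma edge_nat_iso : nat_iso (gsrc e) (gtgt e).
Proof.
have fP p (y : fiber (gsrc e) p) : mvert p (gtgt (sval (lift_src y))) = gtgt e.
  by rewrite mtgt; case: (svalP (lift_src y)) => ->.
have gP p (y : fiber (gtgt e) p) : mvert p (gsrc (sval (lift_tgt y))) = gsrc e.
  by rewrite msrc; case: (svalP (lift_tgt y)) => ->.
exists (fun p y => exist (fun z => mvert p z = gtgt e) _ (fP p y))
  (fun p y => exist (fun z => mvert p z = gsrc e) _ (gP p y)).
- move=> p y; apply: fiber_eq => /=.
  case: (lift_src y) (fP p y) => /= a [ae <-] aP.
  case: (lift_tgt _) => /= b [be ba].
  by rewrite (lift_tgt_uniq be ae ba).
- move=> p y; apply: fiber_eq => /=.
  case: (lift_tgt y) (gP p y) => /= a [ae <-] aP.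
  case: (lift_src _) => /= b [be ba].
  by rewrite (lift_src_uniq be ae ba).
- move=> p q f y; apply: fiber_eq => /=.
  case: (lift_src y) => /= a [ae ay].
  case: (lift_src _) => /= b [be bf].
  rewrite mtgt; congr gtgt; apply: lift_src_uniq => //; first by rewrite ch_edge.
  by rewrite bf -msrc ay.
Qed.

End EdgeLift.

Lemma Pi1_connected : connected_graph X -> groupoid_connected (Pi1 X).
Proof.
move=> [_ conn] v w; elim: (conn v w) => {v w}.
- by move=> v w [e [<- <-]]; exact: (inhabits (edge_nat_iso e)).
- by move=> v; exact: (inhabits (nat_iso_id v)).
- by move=> v w _ [a]; exact: (inhabits (nat_iso_inv a)).
- by move=> u v w _ [a] _ [b]; exact: (inhabits (nat_iso_comp b a)).
Qed.

End Connectedness.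

Definition hmap (G : groupType) (X : graph) (A : graph_action G X)
    (Xconn : connected_graph X) (x : gvert X)
    (y : gvert (fixed_graph A)) : Sec (Pi1_action A) x :=
  sec_class (A := Pi1_action A) (Pi1_connected Xconn) x (svalP y).

(* Main.v *)
From HB Require Import structures.
From mathcomp Require Import boolp classical_sets functions cardinality filter.
From mathcomp Require Import all_boot all_order all_algebra all_fingroup all_solvable zify.
From Stdlib Require Import Relations.
Require Import Defs.

Set Implicit Arguments.
Unset Strict Implicit.
Unset Printing Implicit Defensive.

Local Open Scope group_scope.
Local Open Scope groupoid_scope.

(** A section of the Grothendieck extension is given by natural isomorphisms from the
    fiber functor at [g x] to the one at [x], for [g] in [G], subject to a cocycle
    condition. A natural isomorphism [a] from the fiber functor at [x] to the one at
    [v] is a vertex over [v] of the universal pro-finite covering of [X], and a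
    section is the same as an action of [G] on this pro-finite covering that lifts the
    action on [X]. The vertex [a] is fixed under this action exactly when [v] is fixed
    by [G] and the section is the one defined by [a] ([tfix_secP]). Hence the theorem
    says that the graph of fixed vertices and edges of the universal pro-finite
    covering is nonempty and that its images in [X] are connected: for every section,
    some fixed vertex of [X] defines it ([tfix_exists]), and if two do, they are
    joined in the fixed graph ([fixed_joined]); finally, running along a fixed edge
    does not change the class of sections ([hmap_joined]).

    Connectedness. If the fixed graph of an equivariant covering [Z] separated the
    images of two vertices fixed by a group [K], let [V1] be the component of the
    first image in the fixed graph of [Z]; no edge on the boundary of [V1] is fixed by
    [K]. Then there is a finite equivariant covering of [Z] that counts the crossings
    of this boundary, both along each orbit of edges modulo 2 and along each single
    edge modulo the order of [K], in such a way that a fixed point in it has crossed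
    the boundary an even number of times ([toggle_side]).

    Existence. Fibers being finite, a compactness argument reduces this to the
    existence of a natural isomorphism compatible with the section on one finite
    covering ([tfix_compact]). By passing to a power of that covering one may assume
    that the section has a fixed point [b] in the fiber at [x], and it is enough to
    find a fixed vertex in the component of [b] ([pow_fixed]). Let [K] be a subgroup
    of least order for which this fails. By minimality, each proper subgroup of [K]
    fixes a vertex of the universal pro-finite covering. These vertices are moved
    around in finite coverings in which running along an edge adds an element of an
    abelian group, and the connectedness of the fixed sets of subgroups tells how
    their images are related.

    If [K] has a normal maximal subgroup [N], the component carries a potential with
    values in the cyclic group [K / N], which the vertex fixed by [N] and its
    translates contradict ([normal_maximal_absurd]). Otherwise choose two distinct
    maximal subgroups [M] and [L] whose intersection [U] is as large as possible and
    has its normalizer in [M] ([maximal_pair]). Comparing the vertices fixed by [M]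
    and by [L] inside the fixed set of [U] shows that every [U]-invariant function on
    [G] with values in the field of two elements is the difference of an [L]-invariant
    and an [M]-invariant one ([pot_split]), and counting shows that this is false
    ([linv_not_sum]). *)

(** * Finite sets and orbit representatives *)

Lemma finite_preimage_inj (T U : Type) (f : T -> U) (B : set U) :
  injective f -> finite_set B -> finite_set (f @^-1` B)%classic.
Proof.
move=> fI; apply: card_le_finite; apply: card_ge_preimage => a b _ _; exact: fI.
Qed.

Lemma finite_inj (T : Type) (U : finType) (f : T -> U) :
  injective f -> finite_set [set: T]%classic.
Proof.
move=> fI; have := finite_preimage_inj fI (@finite_finset U [set: U]%classic).
by rewrite preimage_setT.
Qed.

(** The vertex types of the coverings of [X] are bounded by a fixed universe, which
    has to lie below that of [finType]: a finite type cannot be used as a factor of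
    a covering, but the initial segment of [nat] that codes it is in [Set]. *)
Definition seg (n : nat) : Set := {i : nat | (i < n)%N}.

Definition enc (D : finType) (d : D) : seg #|D| :=
  exist _ (enum_rank d : nat) (ltn_ord (enum_rank d)).

Definition dec (D : finType) (s : seg #|D|) : D := enum_val (Ordinal (svalP s)).

Lemma encK (D : finType) : cancel (@enc D) (@dec D).
Proof.
move=> d; rewrite /dec /enc /=; rewrite -[RHS]enum_rankK; congr enum_val; exact: val_inj.
Qed.

Lemma decK (D : finType) : cancel (@dec D) (@enc D).
Proof. by case=> i lt_i; apply: eq_exist => /=; rewrite /dec enum_valK. Qed.

Lemma finite_seg n : finite_set [set: seg n]%classic.
Proof.
apply: (@finite_inj _ 'I_n (fun s => Ordinal (svalP s))) => [[i Hi] [j Hj] [E]].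
exact: eq_exist.
Qed.

Lemma finite_code (E : Type) : finite_set [set: E]%classic ->
  exists n (c : E -> 'I_n) (d : 'I_n -> E), cancel c d /\ cancel d c.
Proof.
move=> /(@finite_seqP {classic E})[s sE].
pose r := undup s.
have rP (e : {classic E}) : e \in r.
  by rewrite mem_undup; have : [set: E]%classic e by []; rewrite sE.
have rE (e : {classic E}) : (index e r < size r)%N by rewrite index_mem.
exists (size r), (fun e => Ordinal (rE e)), (fun i => tnth (in_tuple r) i).
split=> [e|i].
  by apply: (etrans (tnth_nth (e : {classic E}) _ _)); exact: nth_index.
apply: val_inj => /=; rewrite (tnth_nth (tnth (in_tuple r) i)) /=.
by rewrite index_uniq // undup_uniq.
Qed.

Lemma finite_fun (I V : Type) : finite_set [set: I]%classic ->
  finite_set [set: V]%classic -> finite_set [set: I -> V]%classic.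
Proof.
move=> /finite_code[n [c [d [cK dK]]]] /finite_code[N [c' [d' [c'K d'K]]]].
apply: (@finite_inj _ {ffun 'I_n -> 'I_N} (fun f => [ffun i => c' (f (d i))])).
move=> f f' /ffunP E; apply/funext => i; apply: (can_inj c'K).
by have := E (c i); rewrite !ffunE cK.
Qed.

Lemma finite_sig (T : Type) (P : T -> Prop) : finite_set [set: T]%classic ->
  finite_set [set: {z | P z}]%classic.
Proof.
move=> Tfin; have := @finite_preimage_inj _ _ (fun z : {z | P z} => sval z) _ _ Tfin.
by rewrite preimage_setT; apply; move=> [z Pz] [z' Pz'] /= E; exact: eq_exist.
Qed.

(** The representative is chosen from the orbit as a set, hence is invariant. *)
Lemma orbit_reps (G : finGroupType) (K : {group G}) (T : Type) (act : G -> T -> T) :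
  (forall e, act 1 e = e) ->
  (forall g k e, g \in K -> k \in K -> act (g * k) e = act g (act k e)) ->
  exists r : T -> T, (forall e, exists2 g, g \in K & r e = act g e)
  /\ (forall g e, g \in K -> r (act g e) = r e).
Proof.
move=> act1 actM.
pose O e := [set e' : T | exists2 g, g \in K & e' = act g e]%classic.
have Oe e : O e e by exists 1; rewrite ?group1 ?act1.
pose pick (B : set T) (e : T) : T :=
  match pselect (exists e', B e') with left h => sval (cid h) | right _ => e end.
have pickP B e : B e -> B (pick B e).
  by move=> Be; rewrite /pick; case: pselect => [h|[]]; [exact: (svalP (cid h)) | by exists e].
have pickE B e e' : B e -> pick B e = pick B e'.
  by move=> Be; rewrite /pick; case: pselect => // -[]; exists e.
exists (fun e => pick (O e) e); split=> [e|g e Kg]; first exact: (pickP (O e) e (Oe e)).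
have -> : O (act g e) = O e.
  apply/seteqP; split=> e' [k Kk ->].
    by exists (k * g); rewrite ?groupM // actM.
  exists (k * g^-1); rewrite ?groupM ?groupV // actM ?groupV //.
  by rewrite -(actM g^-1) ?groupV // mulVg act1.
by apply: pickE; exists g.
Qed.

(** * Transport of vertices along natural isomorphisms of fiber functors *)

Section Transport.
Variable X : graph.
Implicit Types (u v w : gvert X) (p q : fin_covering X).

(** The action of a natural isomorphism on a fiber, extended by the identity to
    all vertices of the covering, so that no fiber types occur in what follows. *)
Definition app v w (a : nat_iso v w) p (z : gvert (cov_graph p)) :
    gvert (cov_graph p) :=
  match pselect (mvert p z = v) with
  | left e => sval (a p (exist _ z e))
  | right _ => z
  end.

Lemma app_sval v w (a : nat_iso v w) p (y : fiber v p) :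
  app a (sval y) = sval (a p y).
Proof.
rewrite /app; case: pselect => [e|ne]; last by case: ne; exact: (svalP y).
by congr (sval (a p _)); exact: fiber_eq.
Qed.

Lemma appE v w (a : nat_iso v w) p z (e : mvert p z = v) :
  app a z = sval (a p (exist _ z e)).
Proof. exact: (app_sval a (exist _ z e)). Qed.

Lemma app_over v w (a : nat_iso v w) p z : mvert p z = v -> mvert p (app a z) = w.
Proof. by move=> e; rewrite (appE a e); exact: (svalP (a p _)). Qed.

Lemma app_inj v w (a : nat_iso v w) p (z z' : gvert (cov_graph p)) :
  mvert p z = v -> mvert p z' = v -> app a z = app a z' -> z = z'.
Proof.
move=> e e'; rewrite (appE a e) (appE a e') => /fiber_eq /(can_inj (@ni_funK _ _ _ a p)).
by move/(congr1 sval).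
Qed.

Lemma app_comp u v w (a : nat_iso v w) (b : nat_iso u v) p z :
  mvert p z = u -> app (nat_iso_comp a b) z = app a (app b z) :> gvert (cov_graph p).
Proof. by move=> e; rewrite (appE _ e) (appE b e) app_sval. Qed.

Lemma app_invK v w (a : nat_iso v w) p (z : gvert (cov_graph p)) :
  mvert p z = v -> app (nat_iso_inv a) (app a z) = z.
Proof. by move=> e; rewrite (appE a e) app_sval /= ni_funK. Qed.

Lemma app_Kinv v w (a : nat_iso v w) p (z : gvert (cov_graph p)) :
  mvert p z = w -> app a (app (nat_iso_inv a) z) = z.
Proof. by move=> e; rewrite (appE (nat_iso_inv a) e) app_sval /= ni_invK. Qed.

Lemma nat_iso_app v w (a b : nat_iso v w) :
  (forall p (z : gvert (cov_graph p)), mvert p z = v -> app a z = app b z) -> a = b.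
Proof.
by move=> E; apply: nat_iso_eq => p y; rewrite -!app_sval; apply/E/(svalP y).
Qed.

Lemma app_eqhom v w (e : v = w) p (z : gvert (cov_graph p)) :
  mvert p z = v -> app (eqhom (e : v = w :> gobj (Pi1 X)) : nat_iso v w) z = z.
Proof. by move=> E; rewrite (appE _ E) Pi1_eqhomE. Qed.

(** Naturality is used below for maps given by their values on vertices and on
    edges, which spares the construction of a morphism of coverings each time. *)
Lemma app_nat v w (a : nat_iso v w) p q
    (fv : gvert (cov_graph p) -> gvert (cov_graph q))
    (fe : gedge (cov_graph p) -> gedge (cov_graph q)) :
  (forall e, fv (gsrc e) = gsrc (fe e)) -> (forall e, fv (gtgt e) = gtgt (fe e)) ->
  (forall z, mvert q (fv z) = mvert p z) -> (forall e, medge q (fe e) = medge p e) ->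
  forall z, mvert p z = v -> fv (app a z) = app a (fv z).
Proof.
move=> fs ft ov oe z zv.
pose f : cov_hom p q := @CovHom _ p q (GraphMap fs ft) ov oe.
have zv' : mvert q (fv z) = v by rewrite ov.
rewrite (appE a zv) (appE a zv').
exact: (nat_iso_natE a (f := f)).
Qed.

(** A union of components of [p] is itself a covering, and its inclusion is a morphism,
    so that transport does not leave it.  Therefore transport preserves the components
    of [p] and every function that takes the same value at both ends of each edge. *)
Section Subcovering.
Variables (p : fin_covering X) (P : gvert (cov_graph p) -> Prop).
Hypothesis Pedge : forall e, P (gsrc e) <-> P (gtgt e).

Definition sub_graph : graph :=
  @Graph {z | P z} {e | P (gsrc e)}
    (fun e => exist _ (gsrc (sval e)) (svalP e))
    (fun e => exist _ (gtgt (sval e)) ((Pedge (sval e)).1 (svalP e))).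

Definition sub_map : graph_map sub_graph X :=
  @GraphMap sub_graph X (fun z => mvert p (sval z)) (fun e => medge p (sval e))
    (fun e => msrc p (sval e)) (fun e => mtgt p (sval e)).

Lemma sub_covering : is_covering sub_map.
Proof.
move=> e [v Pv]; have [cs ct] := @cov_covering X p e v; split=> /= ve.
- have [e' [[E1 E2] U]] := cs ve; have Pe : P (gsrc e') by rewrite E2.
  exists (exist _ e' Pe); split=> [|[e'' Pe''] /= [F1 /(congr1 sval) /= F2]].
    by split=> //; exact: eq_exist.
  by apply: eq_exist; exact: U.
- have [e' [[E1 E2] U]] := ct ve.
  have Pe : P (gsrc e') by apply/Pedge; rewrite E2.
  exists (exist _ e' Pe); split=> [|[e'' Pe''] /= [F1 /(congr1 sval) /= F2]].
    by split=> //; exact: eq_exist.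
  by apply: eq_exist; exact: U.
Qed.

Lemma sub_finite : is_finite_map sub_map.
Proof.
move=> v; apply: (@finite_preimage_inj _ _ (fun z : gvert sub_graph => sval z)
  (mvert p @^-1` [set v])%classic); last exact: cov_finite.
by move=> [a Pa] [b Pb] /= E; exact: eq_exist.
Qed.

Definition sub_cov : fin_covering X := FinCovering sub_covering sub_finite.

Lemma app_sub v w (a : nat_iso v w) z : P z -> mvert p z = v -> P (app a z).
Proof.
move=> Pz zv.
have := @app_nat v w a sub_cov p (fun z => sval z) (fun e => sval e)
  (fun _ => erefl) (fun _ => erefl) (fun _ => erefl) (fun _ => erefl)
  (exist _ z Pz) zv.
by move=> /= <-; exact: svalP.
Qed.
End Subcovering.

Lemma app_const v w (a : nat_iso v w) p (Q : Type)
    (k : gvert (cov_graph p) -> Q) :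
  (forall e, k (gsrc e) = k (gtgt e)) ->
  forall z, mvert p z = v -> k (app a z) = k z.
Proof.
move=> kE z zv; apply: (app_sub (P := fun y => k y = k z)) => // e.
by rewrite kE.
Qed.

Lemma app_joined v w (a : nat_iso v w) p (z : gvert (cov_graph p)) :
  mvert p z = v -> joined z (app a z).
Proof.
move=> zv; apply: (app_sub (P := fun y => joined z y)) => // [e|]; last exact: rst_refl.
have se : joined (gsrc e) (gtgt e) by apply: rst_step; exists e.
by split=> h; apply: rst_trans h _ => //; apply: rst_sym.
Qed.

(** Lifts of an edge are unique, and a morphism of coverings maps lifts to lifts.
    This makes every path in a covering the transport along a natural isomorphism, see
    [joined_iso], the converse of [app_joined]. *)
Lemma edge_iso (e : gedge X) :
  exists a : nat_iso (gsrc e) (gtgt e), forall p (e' : gedge (cov_graph p)),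
    medge p e' = e -> app a (gsrc e') = gtgt e'.
Proof.
have fP p (y : fiber (gsrc e) p) : mvert p (gtgt (sval (lift_src y))) = gtgt e.
  by rewrite mtgt; case: (svalP (lift_src y)) => ->.
have gP p (y : fiber (gtgt e) p) : mvert p (gsrc (sval (lift_tgt y))) = gsrc e.
  by rewrite msrc; case: (svalP (lift_tgt y)) => ->.
have fK p : cancel (fun y => exist (fun z => mvert p z = gtgt e) _ (fP p y))
    (fun y => exist (fun z => mvert p z = gsrc e) _ (gP p y)).
  move=> y; apply: fiber_eq => /=.
  case: (lift_src y) (fP p y) => /= a [ae <-] aP.
  case: (lift_tgt _) => /= b [be ba].
  by rewrite (lift_tgt_uniq be ae ba).
have gK p : cancel (fun y => exist (fun z => mvert p z = gsrc e) _ (gP p y))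
    (fun y => exist (fun z => mvert p z = gtgt e) _ (fP p y)).
  move=> y; apply: fiber_eq => /=.
  case: (lift_tgt y) (gP p y) => /= a [ae <-] aP.
  case: (lift_src _) => /= b [be ba].
  by rewrite (lift_src_uniq be ae ba).
have fN p q (f : cov_hom p q) (y : fiber (gsrc e) p) :
    exist (fun z => mvert q z = gtgt e) _ (fP q (fiber_map f y))
    = fiber_map f (exist (fun z => mvert p z = gtgt e) _ (fP p y)).
  apply: fiber_eq => /=.
  case: (lift_src y) => /= a [ae ay].
  case: (lift_src _) => /= b [be bf].
  rewrite mtgt; congr gtgt; apply: (lift_src_uniq be); first by rewrite ch_edge.
  by rewrite bf -msrc ay.
exists (NatIso fK gK fN) => p e' pe.
have se : mvert p (gsrc e') = gsrc e by rewrite msrc pe.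
rewrite (appE _ se) /=; case: (lift_src _) => /= b [be bs].
by rewrite (lift_src_uniq be pe bs).
Qed.

Lemma joined_iso p (z z' : gvert (cov_graph p)) v w :
  joined z z' -> mvert p z = v -> mvert p z' = w ->
  exists a : nat_iso v w, app a z = z'.
Proof.
move=> j; elim: j v w => {z z'}.
- move=> z z' [e [<- <-]] v w; rewrite msrc mtgt => <- <-.
  by have [a aE] := edge_iso (medge p e); exists a; exact: aE.
- move=> z v w <- <-; exists (nat_iso_id _).
  by rewrite (appE (nat_iso_id _) (erefl (mvert p z))).
- move=> z z' _ IH v w zv zw; have [a E] := IH w v zw zv.
  by exists (nat_iso_inv a); rewrite -E app_invK.
- move=> z y z' _ IH1 _ IH2 v w zv zw.
  have [a E] := IH1 v _ zv erefl; have [b F] := IH2 _ w erefl zw.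
  by exists (nat_iso_comp b a); rewrite app_comp // E.
Qed.

(** * Twisted products *)

(** Running along an edge [e] of [p] changes a state in the finite set [D] by the
    bijection [tau e].  A function of the vertex of [p] and the state that these changes
    preserve is preserved by all transports, see [tw_const]; all coverings that restrict
    the position of fixed vertices are of this kind. *)
Section TwistedProduct.
Variables (p : fin_covering X) (D : finType).
Variables (tau tau' : gedge (cov_graph p) -> D -> D).
Hypotheses (tauK : forall e, cancel (tau e) (tau' e)).
Hypotheses (tauK' : forall e, cancel (tau' e) (tau e)).

Definition tw_graph : graph :=
  @Graph (gvert (cov_graph p) * seg #|D|) (gedge (cov_graph p) * seg #|D|)
    (fun e => (gsrc e.1, e.2)) (fun e => (gtgt e.1, enc (tau e.1 (dec e.2)))).

Definition tw_map : graph_map tw_graph X :=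
  @GraphMap tw_graph X (fun z => mvert p z.1) (fun e => medge p e.1)
    (fun e => msrc p e.1) (fun e => mtgt p e.1).

Lemma tw_covering : is_covering tw_map.
Proof.
move=> e [v d]; have [cs ct] := @cov_covering X p e v; split=> /= ve.
- have [e' [[E1 E2] U]] := cs ve; exists (e', d); split=> [|[e'' d'] /= [F1 [F2 <-]]].
    by rewrite /= E2.
  by rewrite (U e'').
- have [e' [[E1 E2] U]] := ct ve; exists (e', enc (tau' e' (dec d))).
  split=> [|[e'' d'] /= [F1 [F2 <-]]]; first by rewrite /= E2 encK tauK' decK.
  by rewrite (U e'') // encK tauK decK.
Qed.

Lemma tw_finite : is_finite_map tw_map.
Proof.
move=> v; apply: (@sub_finite_set _ _
  ((mvert p @^-1` [set v]) `*` [set: seg #|D|])%classic); first by move=> [a b].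
by apply: finite_setX; [exact: cov_finite | exact: finite_seg].
Qed.

Definition tw_cov : fin_covering X := FinCovering tw_covering tw_finite.

Definition tw_mk (z : gvert (cov_graph p)) (d : D) : gvert (cov_graph tw_cov) :=
  (z, enc d).
Definition tw_base (z : gvert (cov_graph tw_cov)) : gvert (cov_graph p) := z.1.
Definition tw_val (z : gvert (cov_graph tw_cov)) : D := dec z.2.

Lemma tw_eta z : tw_mk (tw_base z) (tw_val z) = z.
Proof. by case: z => z d; rewrite /tw_mk /tw_val decK. Qed.

Lemma tw_mkK z d : tw_val (tw_mk z d) = d.
Proof. exact: encK. Qed.

Lemma tw_const v w (a : nat_iso v w) (Q : Type)
    (k : gvert (cov_graph p) -> D -> Q) :
  (forall e d, k (gsrc e) d = k (gtgt e) (tau e d)) ->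
  forall z, mvert p (tw_base z) = v ->
    k (tw_base (app a z)) (tw_val (app a z)) = k (tw_base z) (tw_val z).
Proof.
move=> kE z; apply: (@app_const v w a tw_cov Q (fun z => k (tw_base z) (tw_val z))).
by move=> [e d]; rewrite /tw_val /= encK.
Qed.

Lemma app_tw_base v w (a : nat_iso v w) z :
  mvert p (tw_base z) = v -> tw_base (app a z) = app a (tw_base z).
Proof. exact: (@app_nat v w a tw_cov p (fun z => z.1) (fun e => e.1)). Qed.

(** Bijections of [D] commuting with the twist are automorphisms of the product. *)
Lemma app_tw_aut v w (a : nat_iso v w) (s : D -> D) z d :
  (forall e d, s (tau e d) = tau e (s d)) -> mvert p z = v ->
  app a (tw_mk z (s d)) =
  tw_mk (tw_base (app a (tw_mk z d))) (s (tw_val (app a (tw_mk z d)))).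
Proof.
move=> sE zv; have := @app_nat v w a tw_cov tw_cov
  (fun z => tw_mk (tw_base z) (s (tw_val z)))
  (fun e => (e.1, enc (s (dec e.2))) : gedge (cov_graph tw_cov)).
rewrite /tw_mk /tw_base /tw_val.
move=> /(_ _ _ _ _ (tw_mk z d)) /= ->; rewrite ?encK //.
by move=> e; rewrite !encK sE.
Qed.
End TwistedProduct.
End Transport.

(** A covering and its twists have the same vertices, so that the covering in which a
    vertex is transported cannot be inferred from the vertex. *)
Notation appc a p z := (@app _ _ _ a p z).

(** * Equivariant coverings *)

Section Equivariant.
Variables (G : finGroupType) (X : graph) (A : graph_action G X).
Implicit Types (g k : G) (p q : fin_covering X) (K H : {group G}).

(** A finite covering with an action of [K] that lifts the action on [X];
    the maps [eact_v g], [eact_e g] are only meaningful for [g] in [K]. *)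
Record ecover (K : {set G}) := ECover {
  ecov :> fin_covering X;
  eact_v : G -> gvert (cov_graph ecov) -> gvert (cov_graph ecov);
  eact_e : G -> gedge (cov_graph ecov) -> gedge (cov_graph ecov);
  eact_src : forall g e, g \in K -> eact_v g (gsrc e) = gsrc (eact_e g e);
  eact_tgt : forall g e, g \in K -> eact_v g (gtgt e) = gtgt (eact_e g e);
  eact_over : forall g z, g \in K -> mvert ecov (eact_v g z) = actv A g (mvert ecov z);
  eact_overe : forall g e, g \in K -> medge ecov (eact_e g e) = acte A g (medge ecov e);
  eact_v1 : forall z, eact_v 1 z = z;
  eact_e1 : forall e, eact_e 1 e = e;
  eact_vM : forall g k z, g \in K -> k \in K ->
    eact_v (g * k) z = eact_v g (eact_v k z);
  eact_eM : forall g k e, g \in K -> k \in K ->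
    eact_e (g * k) e = eact_e g (eact_e k e)
}.

Definition ecover_sub (H K : {set G}) (sHK : H \subset K) (Z : ecover K) : ecover H :=
  let sub := subsetP sHK in
  @ECover H Z (@eact_v K Z) (@eact_e K Z)
    (fun g e Hg => eact_src e (sub g Hg)) (fun g e Hg => eact_tgt e (sub g Hg))
    (fun g z Hg => eact_over z (sub g Hg)) (fun g e Hg => eact_overe e (sub g Hg))
    (@eact_v1 K Z) (@eact_e1 K Z)
    (fun g k z Hg Hk => eact_vM z (sub g Hg) (sub k Hk))
    (fun g k e Hg Hk => eact_eM e (sub g Hg) (sub k Hk)).

Lemma eact_vK K (Z : ecover K) g z : g \in K -> eact_v g^-1 (eact_v g z) = z :> gvert (cov_graph Z).
Proof. by move=> Kg; rewrite -eact_vM ?groupV // mulVg eact_v1. Qed.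

Lemma eact_vKV K (Z : ecover K) g z : g \in K -> eact_v g (eact_v g^-1 z) = z :> gvert (cov_graph Z).
Proof. by move=> Kg; rewrite -eact_vM ?groupV // mulgV eact_v1. Qed.

Lemma eact_eK K (Z : ecover K) g e : g \in K -> eact_e g^-1 (eact_e g e) = e :> gedge (cov_graph Z).
Proof. by move=> Kg; rewrite -eact_eM ?groupV // mulVg eact_e1. Qed.

Lemma eact_eKV K (Z : ecover K) g e : g \in K -> eact_e g (eact_e g^-1 e) = e :> gedge (cov_graph Z).
Proof. by move=> Kg; rewrite -eact_eM ?groupV // mulgV eact_e1. Qed.

(** On [p], the translate [g(a)] acts by definition as [a] on the twist of [p]. *)
Lemma app_act g v w (a : nat_iso v w) p (y : gvert (cov_graph p)) :
  mvert p y = actv A g v ->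
  appc (act_nat_iso A g a) p y = appc a (twist A g^-1 p) y.
Proof.
move=> yv; rewrite (appE _ yv) /=.
have yv' : mvert (twist A g^-1 p) y = v by rewrite /= yv actvK.
by rewrite (appE a yv'); exact: (nat_iso_sval a (y := to_twist (exist _ y yv))).
Qed.

(** Coverings with the same total graph and the same projection, such as the
    twist by [g * k] and the iterated twist, have the same transport. *)
Lemma app_ext v w (a : nat_iso v w) P (f f' : graph_map P X) cf ff cf' ff'
    (z : gvert P) :
  (forall y, mvert f y = mvert f' y) -> (forall e, medge f e = medge f' e) ->
  mvert f z = v ->
  appc a (@FinCovering X P f cf ff) z = appc a (@FinCovering X P f' cf' ff') z.
Proof.
move=> E F; exact: (@app_nat X v w a (@FinCovering X P f cf ff)
  (@FinCovering X P f' cf' ff') id id).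
Qed.

Lemma app_twistM g k v w (a : nat_iso v w) p (z : gvert (cov_graph p)) :
  mvert (twist A (g * k) p) z = v ->
  appc a (twist A (g * k) p) z = appc a (twist A g (twist A k p)) z.
Proof. by apply: app_ext => e /=; rewrite (actvM, acteM). Qed.

Lemma app_twist1 v w (a : nat_iso v w) p (z : gvert (cov_graph p)) :
  mvert p z = v -> appc a (twist A 1 p) z = appc a p z.
Proof.
move=> zv; case: p z zv => P f cf ff z zv.
by apply: app_ext => [e|e|] /=; rewrite ?(actv1, acte1).
Qed.

(** The lift of [g] to an equivariant covering [Z] is a morphism from [Z] to the
    twist of [Z] by the inverse of [g]. *)
Lemma app_eact K (Z : ecover K) g v w (a : nat_iso v w) (z : gvert (cov_graph Z)) :
  g \in K -> mvert Z z = v ->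
  eact_v g (appc a Z z) = appc a (twist A g^-1 Z) (eact_v g z).
Proof.
move=> Kg; apply: (@app_nat X v w a Z (twist A g^-1 Z) (@eact_v K Z g) (@eact_e K Z g)).
- by move=> e; exact: eact_src.
- by move=> e; exact: eact_tgt.
- by move=> y /=; rewrite eact_over // actvK.
- by move=> y /=; rewrite eact_overe // acteK.
Qed.

(** * The action of a section on the fibers at the base vertex *)

(** A section of the Grothendieck extension assigns to [g] a natural isomorphism [al g]
    from the fiber at [g x] to the fiber at [x]; [alM] is its multiplicativity, read on
    the vertices of a covering. *)
Section Cocycle.
Variables (x : gvert X) (al : forall g, nat_iso (actv A g x) x).
Hypothesis alM : forall g k p (y : gvert (cov_graph p)),
  mvert p y = actv A (g * k) x ->
  appc (al (g * k)) p y = appc (al g) p (appc (al k) (twist A g^-1 p) y).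

Lemma al1 p (y : gvert (cov_graph p)) : mvert p y = x -> appc (al 1) p y = y.
Proof.
move=> yx; have yx1 : mvert p y = actv A 1 x by rewrite actv1.
have zx : mvert (twist A 1^-1 p) y = actv A 1 x by rewrite /= invg1 !actv1.
have := alM (g := 1) (k := 1) (p := p) (y := y); rewrite mulg1 => /(_ yx1).
rewrite invg1 (app_twist1 (al 1) yx1) => E.
apply/esym/(app_inj (a := al 1)) => //.
by rewrite (app_over (al 1) yx1) actv1.
Qed.

(** The action of [K] on the fiber of [Z] over the base vertex: a lift moves
    it to the fiber over the translated base vertex, and [al] moves it back. *)
Definition sact K (Z : ecover K) g (z : gvert (cov_graph Z)) : gvert (cov_graph Z) :=
  appc (al g) Z (eact_v g z).

Section Sact.
Variables (K : {group G}) (Z : ecover K).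
Implicit Types z : gvert (cov_graph Z).

Lemma sact_over g z : g \in K -> mvert Z z = x -> mvert Z (sact g z) = x.
Proof. by move=> Kg zx; apply: app_over; rewrite eact_over // zx. Qed.

Lemma sact1 z : mvert Z z = x -> sact 1 z = z.
Proof. by move=> zx; rewrite /sact al1 eact_v1. Qed.

Lemma sactM g k z : g \in K -> k \in K -> mvert Z z = x ->
  sact (g * k) z = sact g (sact k z).
Proof.
move=> Kg Kk zx; rewrite /sact alM ?eact_over ?groupM ?zx //.
by rewrite eact_vM // (app_eact _ Kg) // eact_over // zx.
Qed.
End Sact.

(** * Vertices of the universal pro-finite covering *)

(** A natural isomorphism [a] from the fiber at [x] to the fiber at [v] is a vertex
    over [v] of the universal pro-finite covering, on which [G] acts through [al];
    this says that [a] is fixed by [K]. *)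
Definition tfix (K : {set G}) v (a : nat_iso x v) : Prop :=
  forall g, g \in K -> forall p (y : gvert (cov_graph p)), mvert p y = actv A g x ->
    appc a p (appc (al g) p y) = appc a (twist A g^-1 p) y.

Lemma tfix_sub (H K : {set G}) v (a : nat_iso x v) :
  H \subset K -> tfix K a -> tfix H a.
Proof. by move=> /subsetP sHK aK g /sHK; exact: aK. Qed.

Lemma tfix_sact (H : {set G}) K (Z : ecover K) v (a : nat_iso x v) g
    (z : gvert (cov_graph Z)) :
  tfix H a -> g \in H -> g \in K -> mvert Z z = x ->
  appc a Z (sact g z) = eact_v g (appc a Z z).
Proof.
by move=> aH Hg Kg zx; rewrite /sact aH ?eact_over ?zx // -(app_eact a Kg zx).
Qed.

(** The action of [G] on the vertices of the universal pro-finite covering. *)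
Definition ttrans k v (a : nat_iso x v) : nat_iso x (actv A k v) :=
  nat_iso_comp (act_nat_iso A k a) (nat_iso_inv (al k)).

Lemma app_ttrans k v (a : nat_iso x v) p (y : gvert (cov_graph p)) :
  mvert p y = actv A k x ->
  appc (ttrans k a) p (appc (al k) p y) = appc a (twist A k^-1 p) y.
Proof.
move=> yx; rewrite app_comp; last exact: app_over.
by rewrite app_invK // app_act.
Qed.

(** The image of [z] under the translate of [a] by [k] is found by moving [z] back with
    the section and moving the image under [a] forward with the action on [Z]. *)
Lemma ttrans_sact K (Z : ecover K) k v (a : nat_iso x v) (z : gvert (cov_graph Z)) :
  k \in K -> mvert Z z = x ->
  appc (ttrans k a) Z (sact k z) = eact_v k (appc a Z z).
Proof.
by move=> Kk zx; rewrite app_ttrans ?eact_over ?zx // -(app_eact a Kk zx).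
Qed.

Lemma tfix_ttrans (K : {set G}) k v (a : nat_iso x v) :
  k \in 'N(K) -> tfix K a -> tfix K (ttrans k a).
Proof.
move=> nKk aK g Kg p y yx.
have Kgk : g ^ k \in K by rewrite memJ_norm.
have E : g * k = k * (g ^ k) by rewrite conjgE !mulgA mulgV mul1g.
(* [u] is the point of the fiber at [g k x] that [al k] moves to [y]. *)
pose u : gvert (cov_graph p) := appc (nat_iso_inv (al k)) (twist A g^-1 p) y.
have yx' : mvert (twist A g^-1 p) y = x by rewrite /= yx actvK.
have ux : mvert (twist A g^-1 p) u = actv A k x.
  exact: (app_over (nat_iso_inv (al k)) yx').
have ux2 : mvert p u = actv A (g * k) x.
  by rewrite actvM -ux /= actvKV.
have yE : y = appc (al k) (twist A g^-1 p) u by rewrite app_Kinv.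
have -> : appc (al g) p y = appc (al k) p (appc (al (g ^ k)) (twist A k^-1 p) u).
  rewrite yE -alM // -alM; last by rewrite -E.
  by move: ux2; rewrite E.
have vx : mvert (twist A k^-1 p) u = actv A (g ^ k) x.
  by rewrite [LHS]/= ux2 E actvM actvK.
rewrite app_ttrans; last first.
  by move/(congr1 (actv A k)): (app_over (al (g ^ k)) vx); rewrite /= actvKV.
rewrite aK // yE [RHS]app_ttrans //.
rewrite -!app_twistM ?/= -?invMg ?E //; first by rewrite ux2 E actvK.
by rewrite -E ux2 actvK.
Qed.
End Cocycle.
End Equivariant.

(** * Compactness *)

Lemma ultra_finite (T V : Type) (U : set_system T) (h : T -> V) :
  UltraFilter U -> finite_set [set: V]%classic ->
  exists w, U [set t | h t = w]%classic.
Proof.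
move=> UU /finite_code[n [c [d [cK dK]]]].
suff [i Ui] : exists i, U [set t | c (h t) = i]%classic.
  by exists (d i); apply: filterS Ui => t /= <-; rewrite cK.
have : U [set t | c (h t) \in enum 'I_n]%classic.
  by apply: filterS (@filterT _ U _) => t _ /=; rewrite mem_enum.
elim: (enum 'I_n) => [|i s IH] Us.
  by have [t] := filter_ex Us.
have [|Un] := in_ultra_setVsetC [set t | c (h t) = i]%classic UU; first by exists i.
apply: IH; apply: filterS (filterI Us Un) => t /= [+ ni].
by rewrite inE; case/orP=> // /eqP /ni.
Qed.

Section Limits.
Variables (X : graph) (Xfin : finite_graph X).
Implicit Types (p q : fin_covering X).

Lemma cov_finite_vert p : finite_set [set: gvert (cov_graph p)]%classic.
Proof.
apply: (@sub_finite_set _ _ (\bigcup_(v in [set: gvert X]) (mvert p @^-1` [set v]))%classic).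
  by move=> z _; exists (mvert p z).
by apply: bigcup_finite => [|v _]; [exact: Xfin.1 | exact: cov_finite].
Qed.

Lemma cov_finite_edge p : finite_set [set: gedge (cov_graph p)]%classic.
Proof.
apply: (@sub_finite_set _ _
  ((fun e => (gsrc e, medge p e)) @^-1` [set: gvert (cov_graph p) * gedge X])%classic) => //.
apply: finite_preimage_inj.
  by move=> a b [ab E]; apply: (lift_src_uniq (e := medge p b)) E _ ab.
apply: (@sub_finite_set _ _ ([set: gvert (cov_graph p)] `*` [set: gedge X])%classic) => //.
by apply: finite_setX; [exact: cov_finite_vert | exact: Xfin.2].
Qed.

Lemma id_covering : is_covering (@GraphMap X X id id (fun _ => erefl) (fun _ => erefl)).
Proof. by move=> e v; split=> /= ve; exists e; split=> // e' []. Qed.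

Lemma id_finite : is_finite_map (@GraphMap X X id id (fun _ => erefl) (fun _ => erefl)).
Proof. by move=> v; apply: sub_finite_set (finite_set1 v) => w. Qed.

Definition id_cov : fin_covering X := FinCovering id_covering id_finite.

Definition sum_graph (P Q : graph) : graph :=
  @Graph (gvert P + gvert Q) (gedge P + gedge Q)
    (fun e => match e with inl a => inl (gsrc a) | inr b => inr (gsrc b) end)
    (fun e => match e with inl a => inl (gtgt a) | inr b => inr (gtgt b) end).

Definition sum_map p q : graph_map (sum_graph (cov_graph p) (cov_graph q)) X.
Proof.
exists (fun z => match z with inl a => mvert p a | inr b => mvert q b end)
  (fun e => match e with inl a => medge p a | inr b => medge q b end).
- by case=> e /=; exact: msrc.
- by case=> e /=; exact: mtgt.
Defined.

Lemma sum_covering p q : is_covering (sum_map p q).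
Proof.
move=> e [z|z] /=.
- have [cs ct] := @cov_covering X p e z; split=> ze.
  + have [e' [[E1 E2] U]] := cs ze; exists (inl e'); split=> [|[a|b] /= [F F']].
    * by rewrite /= E2.
    * by rewrite (U a) //; case: F'.
    * by [].
  + have [e' [[E1 E2] U]] := ct ze; exists (inl e'); split=> [|[a|b] /= [F F']].
    * by rewrite /= E2.
    * by rewrite (U a) //; case: F'.
    * by [].
- have [cs ct] := @cov_covering X q e z; split=> ze.
  + have [e' [[E1 E2] U]] := cs ze; exists (inr e'); split=> [|[a|b] /= [F F']].
    * by rewrite /= E2.
    * by [].
    * by rewrite (U b) //; case: F'.
  + have [e' [[E1 E2] U]] := ct ze; exists (inr e'); split=> [|[a|b] /= [F F']].
    * by rewrite /= E2.
    * by [].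
    * by rewrite (U b) //; case: F'.
Qed.

Lemma sum_finite p q : is_finite_map (sum_map p q).
Proof.
move=> v; apply: (@sub_finite_set _ _ (inl @` (mvert p @^-1` [set v]) `|`
   inr @` (mvert q @^-1` [set v]))%classic).
  by case=> z /= zv; [left|right]; exists z.
by rewrite finite_setU; split; apply: finite_image; exact: cov_finite.
Qed.

Definition sum_cov p q : fin_covering X := FinCovering (@sum_covering p q) (@sum_finite p q).

(** All fibers being finite, the image of each vertex of a covering is constant on a set
    of the ultrafilter.  These constants form a natural isomorphism: each condition on
    it concerns finitely many vertices, so that it is inherited from some member. *)
Lemma ultra_limit x (U : set_system {v & nat_iso x v}) : UltraFilter U ->
  exists v (a : nat_iso x v), forall p (z : gvert (cov_graph p)), mvert p z = x ->
    U [set t | appc (tagged t) p z = appc a p z]%classic.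
Proof.
move=> UU.
have [v Uv] := ultra_finite (fun t => tag t) UU Xfin.1.
have Lf p (z : gvert (cov_graph p)) :
    {w | U [set t | appc (tagged t) p z = w]%classic}.
  exact/cid/ultra_finite/cov_finite_vert.
have Lg p (z : gvert (cov_graph p)) :
    {w | U [set t | appc (nat_iso_inv (tagged t)) p z = w]%classic}.
  exact/cid/ultra_finite/cov_finite_vert.
have fP p (y : fiber x p) : mvert p (sval (Lf p (sval y))) = v.
  case: (Lf _ _) => w /= Uw; have [[u a] /= [<- <-]] := filter_ex (filterI Uv Uw).
  exact: (app_over a (svalP y)).
have gP p (y : fiber v p) : mvert p (sval (Lg p (sval y))) = x.
  case: (Lg _ _) => w /= Uw; have [[u a] /= [uv <-]] := filter_ex (filterI Uv Uw).
  by apply: app_over; rewrite (svalP y).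
pose f p y := exist (fun z => mvert p z = v) _ (fP p y).
pose g p y := exist (fun z => mvert p z = x) _ (gP p y).
have fK p : cancel (f p) (g p).
  move=> y; apply: fiber_eq => /=.
  case: (Lf _ _) (fP p y) => w /= Uw wv; case: (Lg _ _) => w' /= Uw'.
  have [[u a] /= [Ew <-]] := filter_ex (filterI Uw Uw').
  by rewrite -Ew app_invK //; exact: (svalP y).
have gK p : cancel (g p) (f p).
  move=> y; apply: fiber_eq => /=.
  case: (Lg _ _) (gP p y) => w /= Uw wv; case: (Lf _ _) => w' /= Uw'.
  have [[u a] /= [uv [Ew <-]]] := filter_ex (filterI Uv (filterI Uw Uw')).
  by rewrite -Ew app_Kinv //; rewrite (svalP y).
have fN p q (h : cov_hom p q) (y : fiber x p) : f q (fiber_map h y) = fiber_map h (f p y).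
  apply: fiber_eq => /=.
  case: (Lf _ _) => w /= Uw; case: (Lf _ _) => w' /= Uw'.
  have [[u a] /= [<- <-]] := filter_ex (filterI Uw Uw').
  rewrite (@app_nat X x u a p q (mvert h) (medge h)) ?(svalP y) //.
  - by move=> e; exact: msrc.
  - by move=> e; exact: mtgt.
  - exact: ch_vert.
  - exact: ch_edge.
exists v, (NatIso fK gK fN) => p z zx.
rewrite (appE (NatIso fK gK fN) zx) /=.
by case: (Lf _ _) => w /=.
Qed.
End Limits.

Section Compactness.
Variables (G : finGroupType) (X : graph) (A : graph_action G X).
Variables (Xfin : finite_graph X).
Variables (x : gvert X) (al : forall g, nat_iso (actv A g x) x).

Definition tfix_at (K : {set G}) v (a : nat_iso x v) p : Prop :=
  forall g, g \in K -> forall y : gvert (cov_graph p), mvert p y = actv A g x ->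
    appc a p (appc (al g) p y) = appc a (twist A g^-1 p) y.

(** The conditions imposed by single coverings are directed. *)
Lemma tfix_at_sum K v (a : nat_iso x v) p q :
  tfix_at K a (sum_cov p q) -> tfix_at K a p /\ tfix_at K a q.
Proof.
move=> aK; split=> g Kg y yx.
- have zx : mvert (twist A g^-1 p) y = x by rewrite /= yx actvK.
  have := aK g Kg (inl y) yx.
  rewrite -(@app_nat X _ _ (al g) p (sum_cov p q) inl inl) //.
  rewrite -(@app_nat X _ _ a p (sum_cov p q) inl inl) //; last exact: (app_over _ yx).
  rewrite -(@app_nat X _ _ a (twist A g^-1 p) (twist A g^-1 (sum_cov p q)) inl inl) //.
  by case.
- have zx : mvert (twist A g^-1 q) y = x by rewrite /= yx actvK.
  have := aK g Kg (inr y) yx.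
  rewrite -(@app_nat X _ _ (al g) q (sum_cov p q) inr inr) //.
  rewrite -(@app_nat X _ _ a q (sum_cov p q) inr inr) //; last exact: (app_over _ yx).
  rewrite -(@app_nat X _ _ a (twist A g^-1 q) (twist A g^-1 (sum_cov p q)) inr inr) //.
  by case.
Qed.

(** The sets of natural isomorphisms compatible with one covering have the finite
    intersection property by [tfix_at_sum]; a limit along an ultrafilter containing them
    is compatible with all coverings. *)
Lemma tfix_compact (K : {set G}) :
  (forall p, exists v (a : nat_iso x v), tfix_at K a p) ->
  exists v (a : nat_iso x v), tfix al K a.
Proof.
move=> ex_at.
pose B p := [set t : {v & nat_iso x v} | tfix_at K (tagged t) p]%classic.
have BF : ProperFilter (filter_from [set: fin_covering X]%classic B).
  apply: filter_from_proper => [|p _]; last first.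
    by have [v [a aK]] := ex_at p; exists (existT _ v a).
  apply: filter_from_filter => [|p q _ _].
    by exists (id_cov X).
  exists (sum_cov p q) => // t /tfix_at_sum[tp tq].
  by split.
have [U [UU sU]] := ultraFilterLemma BF.
have [v [a aU]] := ultra_limit Xfin UU.
exists v, a => g Kg p y yx.
have UB : U (B p) by apply: sU; exists p.
have U1 := aU (twist A g^-1 p) y _.
have U2 := aU p (appc (al g) p y) (app_over (al g) yx).
have yx' : mvert (twist A g^-1 p) y = x by rewrite /= yx actvK.
have [[w b] [/= + [<- <-]]] := filter_ex (filterI UB (filterI U2 (U1 yx'))).
exact.
Qed.
End Compactness.

(** * Connectedness of the fixed set *)

(** An action of [K] on the set of states that is compatible with the changes along the
    edges lifts the action on [Z] to the twisted product. *)
Section EquivariantTwist.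
Variables (G : finGroupType) (X : graph) (A : graph_action G X) (K : {group G}).
Variables (Z : ecover A K) (D : finType).
Variables (tau tau' : gedge (cov_graph Z) -> D -> D).
Hypotheses (tauK : forall e, cancel (tau e) (tau' e)).
Hypotheses (tauK' : forall e, cancel (tau' e) (tau e)).
Variable rho : G -> D -> D.
Hypothesis rho1 : forall d, rho 1 d = d.
Hypothesis rhoM : forall g k d, g \in K -> k \in K -> rho (g * k) d = rho g (rho k d).
Hypothesis rho_tau : forall g e d, g \in K ->
  rho g (tau e d) = tau (eact_e g e) (rho g d).

Definition tw_ecover : ecover A K.
Proof.
exists (tw_cov tauK tauK') (fun g z => (eact_v g z.1, enc (rho g (dec z.2))))
  (fun g e => (eact_e g e.1, enc (rho g (dec e.2)))).
- by move=> g e Kg /=; rewrite eact_src.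
- by move=> g e Kg /=; rewrite eact_tgt // !encK rho_tau.
- by move=> g z Kg /=; rewrite eact_over.
- by move=> g e Kg /=; rewrite eact_overe.
- by case=> z d /=; rewrite eact_v1 rho1 decK.
- by case=> e d /=; rewrite eact_e1 rho1 decK.
- by move=> g k [z d] Kg Kk /=; rewrite eact_vM // rhoM // encK.
- by move=> g k [e d] Kg Kk /=; rewrite eact_eM // rhoM // encK.
Defined.

Lemma eact_tw_mk g z d :
  @eact_v _ _ _ _ tw_ecover g (tw_mk tauK tauK' z d) = tw_mk tauK tauK' (eact_v g z) (rho g d).
Proof. by rewrite /= /tw_mk encK. Qed.
End EquivariantTwist.

Section FixedJoined.
Variables (G : finGroupType) (X : graph) (A : graph_action G X).
Hypothesis Xfin : finite_graph X.
Variables (x : gvert X) (al : forall g, nat_iso (actv A g x) x).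
Variables (K : {group G}).

Section FixedEdges.
Variable Z : ecover A K.
Definition efixed (e : gedge (cov_graph Z)) : Prop :=
  forall g, g \in K -> eact_e g e = e.
Definition vfixed (z : gvert (cov_graph Z)) : Prop :=
  forall g, g \in K -> eact_v g z = z.
Definition fjoined : gvert (cov_graph Z) -> gvert (cov_graph Z) -> Prop :=
  clos_refl_sym_trans _ (fun z z' => exists e, [/\ efixed e, gsrc e = z & gtgt e = z']).

Lemma fjoined_vfixed z z' : fjoined z z' -> vfixed z <-> vfixed z'.
Proof.
elim=> {z z'} [z z' [e [fe <- <-]]|z|z z' _ IH|z y z' _ IH1 _ IH2] //.
- by split=> _ g Kg; rewrite (eact_src, eact_tgt) // fe.
- by split=> /IH.
- by split=> [/IH1/IH2|/IH2/IH1].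
Qed.

Lemma fjoined_joined z z' : fjoined z z' -> joined z z'.
Proof.
elim=> {z z'} [z z' [e [fe <- <-]]|z|z z' _ IH|z y z' _ IH1 _ IH2].
- by apply: rst_step; exists e.
- exact: rst_refl.
- exact: rst_sym.
- exact: rst_trans IH2.
Qed.

(** Only the edges in the component of [z] matter: this will be where stabilizers are
    known to be proper. *)
Lemma fjoined_const (Q : Type) (k : gvert (cov_graph Z) -> Q) z z' :
  (forall e, efixed e -> joined z (gsrc e) -> k (gsrc e) = k (gtgt e)) ->
  fjoined z z' -> k z = k z'.
Proof.
move=> kE zz'.
suff H y y' : fjoined y y' -> joined z y -> k y = k y' by apply: H zz' _; exact: rst_refl.
elim=> {y y' zz'} [y y' [e [fe <- <-]]|y|y y' h IH|y u y' h1 IH1 h2 IH2] // zy.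
- exact: kE.
- by rewrite IH //; apply: rst_trans zy _; apply/rst_sym/fjoined_joined.
- by rewrite IH1 // IH2 //; apply: rst_trans zy _; exact: fjoined_joined.
Qed.
End FixedEdges.

(** Let [V1] be a [K]-invariant set of vertices of [Z] such that no edge leaving or
    entering it is fixed by [K].  The state of the covering below records crossings of
    the boundary of [V1]: crossing the edge [e] flips a bit attached to the orbit of [e]
    and changes a counter in the integers modulo [#|K|] attached to [e] itself, upwards
    and downwards in turn as told by the bit.  The parity of the bits tells whether one
    is still on the side of [V1] from which one started, and the sum of the counters
    over [k e], for [k] in [K], is the order of the stabilizer of [e] times the bit.
    A state fixed by [K] has constant counters on each orbit, so that this sum vanishes
    modulo [#|K|]; as the stabilizers are proper, all bits are zero. *)
Section Toggle.
Variable Z : ecover A K.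
Let V := gvert (cov_graph Z).
Let E := gedge (cov_graph Z).
Variables (V1 : V -> bool).
Let cross (e : E) := V1 (gsrc e) != V1 (gtgt e).
Hypothesis V1K : forall g z, g \in K -> V1 (eact_v g z) = V1 z.
Hypothesis nfix : forall e, cross e -> ~ efixed e.
Variables (n : nat) (c : E -> 'I_n) (d : 'I_n -> E).
Hypotheses (cK : cancel c d) (dK : cancel d c).

Variable r : E -> E.
Hypothesis rP : forall e, exists2 g, g \in K & r e = eact_e g e.
Hypothesis rK : forall g e, g \in K -> r (eact_e g e) = r e.

Let m := #|K|.
Let D : finType := ({ffun 'I_n -> bool} * {ffun 'I_n -> 'Z_m})%type.

Let tog (e : E) (s : D) : D :=
  if cross e then
    ([ffun i => (i == c (r e)) (+) s.1 i],
     [ffun i => s.2 i + (if i == c e then (-1) ^+ s.1 (c (r e)) else 0)]%R)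
  else s.

Lemma togK e : cancel (tog e) (tog e).
Proof.
rewrite /tog; case: (cross e) => // -[s f]; congr pair; apply/ffunP => i; rewrite !ffunE /=.
  by case: eqP => // _; case: (s i).
rewrite ?ffunE ?eqxx /=; case: eqP => // _; last by rewrite !GRing.addr0.
by rewrite -GRing.addrA; case: (s _); rewrite /= ?GRing.expr0 ?GRing.expr1 ?GRing.addNr ?GRing.subrr GRing.addr0.
Qed.

Let rho (g : G) (s : D) : D := (s.1, [ffun i => s.2 (c (eact_e g^-1 (d i)))]).

Lemma cross_act g e : g \in K -> cross (eact_e g e) = cross e.
Proof. by move=> Kg; rewrite /cross -eact_src // -eact_tgt // !V1K. Qed.

Lemma toggle_act1 s : rho 1 s = s.
Proof.
case: s => s f; congr pair; apply/ffunP => i.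
by rewrite ffunE invg1 eact_e1 dK.
Qed.

Lemma toggle_actM g k s : g \in K -> k \in K -> rho (g * k) s = rho g (rho k s).
Proof.
move=> Kg Kk; congr pair; apply/ffunP => i.
by rewrite !ffunE /= cK invMg eact_eM ?groupV.
Qed.

Lemma toggle_act_tog g e s : g \in K -> rho g (tog e s) = tog (eact_e g e) (rho g s).
Proof.
move=> Kg; rewrite /tog cross_act //; case: (cross e) => //; rewrite rK //.
congr pair; apply/ffunP => i; rewrite !ffunE //=.
rewrite [_ == c e](_ : _ = (i == c (eact_e g e))) //.
apply/eqP/eqP => [/(can_inj cK) ie|->]; last by rewrite cK eact_eK.
by apply: (can_inj dK); rewrite cK -ie eact_eKV.
Qed.

Definition toggle_cover : ecover A K := tw_ecover togK togK toggle_act1 toggle_actM toggle_act_tog.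

Let y0 (y : V) := tw_mk togK togK y ([ffun=> false], [ffun=> 0%R]).

Lemma toggle_side v w (a : nat_iso v w) (y : V) :
  mvert Z y = v -> vfixed (Z := toggle_cover) (app a (y0 y)) -> V1 (app a y) = V1 y.
Proof.
move=> yv yfix.
pose z := app a (y0 y); pose y' := tw_base z; pose s := tw_val z.
have y'E : y' = app a y by rewrite /y' app_tw_base.
have sK g i : g \in K -> s.2 (c (eact_e g^-1 (d i))) = s.2 i.
  move=> Kg; have := yfix g Kg; rewrite -/z -(tw_eta z) eact_tw_mk.
  move/(congr1 (fun z => (tw_val z).2)) => /=; rewrite /tw_val /= !encK.
  by move/ffunP/(_ i); rewrite ffunE.
have sc e g : g \in K -> s.2 (c (eact_e g e)) = s.2 (c e).
  by move=> Kg; rewrite -[RHS](sK g^-1) ?groupV // invgK cK.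
pose q (e : E) := #|[set k in K | c (eact_e k e) == c e]%SET|.
have qE e : cross e ->
    (\sum_(k in K) s.2 (c (eact_e k e)) - (q e)%:R *+ s.1 (c (r e)) = 0 :> 'Z_m)%R.
  move=> ce; pose k0 (_ : V) (s : D) : 'Z_m :=
    (\sum_(k in K) s.2 (c (eact_e k e)) - (q e)%:R *+ s.1 (c (r e)))%R.
  suff k0E e' t : k0 (gsrc e') t = k0 (gtgt e') (tog e' t).
    have := tw_const (tauK := togK) (tauK' := togK) a k0E (z := y0 y) yv.
    rewrite /k0 -/z -/s => ->; rewrite /y0 tw_mkK /= ffunE GRing.mulr0n GRing.subr0.
    by rewrite big1 // => k _; rewrite ffunE.
  rewrite /k0 /tog; case ce': (cross e') => //=.
  rewrite ffunE; under [in RHS]eq_bigr do rewrite ffunE.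
  rewrite big_split /= -big_mkcondr /= GRing.sumr_const.
  have [er|ner] := pselect (r e' = r e); last first.
    rewrite [X in (_ + _ *+ X - _)%R](_ : _ = 0%N); last first.
      apply: eq_card0 => k; rewrite !inE; apply/negP => /andP[Kk /eqP/(can_inj cK) ke].
      by apply: ner; rewrite -ke rK.
    rewrite GRing.mulr0n GRing.addr0; case: eqP => // /(can_inj cK) re.
    by case: ner.
  (* The terms that change are indexed by a coset of the stabilizer of [e]. *)
  have [h Kh he] : exists2 h, h \in K & e' = eact_e h e.
    have [g Kg gE] := rP e; have [g' Kg' gE'] := rP e'.
    exists (g'^-1 * g); first by rewrite groupM ?groupV.
    by rewrite eact_eM ?groupV // -gE -er gE' eact_eK.
  rewrite -er eqxx [X in (_ + _ *+ X - _)%R](_ : _ = q e).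
    by case: (t.1 _); rewrite /= ?GRing.expr0 ?GRing.expr1 ?GRing.mulr1n ?GRing.mulr0n
      ?GRing.subr0 ?GRing.addrK // GRing.mulNrn.
  rewrite /q -(card_lcoset _ h); apply: eq_card => k; rewrite mem_lcoset !inE.
  rewrite (groupMl _ (groupVr Kh)) he; apply: andb_id2l => Kk.
  apply/eqP/eqP => /(can_inj cK) F; congr c.
    by rewrite eact_eM ?groupV // F eact_eK.
  by rewrite -[in RHS]F -eact_eM ?groupM ?groupV // mulKVg.
have s0 e : cross e -> s.1 (c (r e)) = false.
  move=> ce; have := qE e ce; under eq_bigr do rewrite sc //.
  have [g Kg gE] : exists2 g, g \in K & eact_e g e != e :> {classic _}.
    apply/not_exists2P => H; apply: (nfix ce) => g Kg.
    by have [//|/negP] := H g; rewrite negbK => /eqP.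
  have qK : (q e < m)%N.
    apply: proper_card; apply/properP; split; first by apply/subsetP => k; rewrite inE => /andP[].
    exists g => //; rewrite inE Kg /=; apply/negP => /eqP/(can_inj cK) ge.
    by move: gE; rewrite ge eqxx.
  have m1 : (1 < m)%N.
    apply: leq_ltn_trans qK; apply/card_gt0P; exists 1.
    by rewrite inE group1 eact_e1 /=.
  have m0 : (m%:R : 'Z_m)%R = 0%R by apply: val_inj; rewrite /= val_Zp_nat // modnn.
  rewrite GRing.sumr_const -[X in (X - _)%R]GRing.mulr_natr -/m m0.
  rewrite GRing.mulr0 GRing.sub0r; case: (s.1 _) => //= /eqP.
  rewrite GRing.oppr_eq0 -val_eqE /= GRing.mulr1n val_Zp_nat // modn_small //.
  rewrite cards_eq0 => /eqP/setP/(_ 1); rewrite !inE group1 eact_e1 eqxx.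
  by [].
pose k1 (u : V) (s : D) : bool :=
  V1 u (+) \big[addb/false]_(i | (c (r (d i)) == i) && cross (d i)) s.1 i.
suff k1E e t : k1 (gsrc e) t = k1 (gtgt e) (tog e t).
  have := tw_const (tauK := togK) (tauK' := togK) a k1E (z := y0 y) yv.
  rewrite /k1 -/z -/y' -/s y'E.
  rewrite [X in _ = _ (+) X]big1 => [|i _]; last by rewrite /y0 tw_mkK /= ffunE.
  rewrite [X in _ (+) X = _]big1 ?addbF // => i /andP[/eqP ri ci].
  by rewrite -ri s0.
rewrite /k1 /tog; case ce: (cross e); last by congr addb; move/negbFE/eqP: ce.
have i0P : (c (r (d (c (r e)))) == c (r e)) && cross (d (c (r e))).
  rewrite cK; have [g Kg gE] := rP e.
  have -> : cross (r e) by rewrite gE cross_act.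
  by rewrite andbT {1}gE rK.
rewrite [in LHS](bigD1 (c (r e))) //= [in RHS](bigD1 (c (r e))) //= ffunE eqxx /=.
rewrite [X in _ = _ (+) (_ (+) X)](eq_bigr (fun i => t.1 i)); last first.
  by move=> i /andP[_ /negbTE ni]; rewrite ffunE ni.
move: ce; rewrite /cross; case: (V1 _); case: (V1 _) => // _;
by case: (t.1 _); case: (\big[_/_]_(_ | _) _).
Qed.
End Toggle.

(** Two vertices [a] and [a'] of the universal pro-finite covering that are fixed by [K]
    cannot be separated: were their images in [Z] in different components of the graph
    of [K]-fixed vertices and edges, the component of the first would have no fixed
    edge on its boundary, and the image of [a'] in the associated toggle covering, a
    fixed vertex reached from the image of [a], would contradict [toggle_side]. *)
Lemma fixed_joined (Z : ecover A K) v v' (a : nat_iso x v) (a' : nat_iso x v')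
    (z : gvert (cov_graph Z)) :
  tfix al K a -> tfix al K a' -> mvert Z z = x ->
  (forall g, g \in K -> sact al g z = z) ->
  fjoined (appc a Z z) (appc a' Z z).
Proof.
move=> aK a'K zx zfix; apply: contrapT => nj.
have yfix : vfixed (app a z) by move=> g Kg; rewrite -(tfix_sact aK Kg Kg zx) zfix.
pose V1 (u : gvert (cov_graph Z)) := `[< fjoined (app a z) u >].
have V1K g u : g \in K -> V1 (eact_v g u) = V1 u.
  move=> Kg; rewrite /V1; apply: asbool_equiv_eq; split=> h.
    have ufix := (fjoined_vfixed h).1 yfix.
    suff -> : u = eact_v g u by [].
    by rewrite -{1}[u](eact_vK u Kg) ufix ?groupV.
  by rewrite ((fjoined_vfixed h).1 yfix).
have nfix e : V1 (gsrc e) != V1 (gtgt e) -> ~ efixed e.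
  move=> + fe; move/negP; apply; apply/eqP; rewrite /V1; apply: asbool_equiv_eq.
  have h : fjoined (gsrc e) (gtgt e) by apply: rst_step; exists e.
  by split=> h'; apply: rst_trans h' _ => //; apply: rst_sym.
have [n [c [d [cK dK]]]] := finite_code (cov_finite_edge Xfin Z).
have [r [rP rK]] := orbit_reps (@eact_e1 _ _ _ _ Z) (@eact_eM _ _ _ _ Z).
pose b := nat_iso_comp a' (nat_iso_inv a).
have zE : app b (app a z) = app a' z.
  by rewrite app_comp ?app_invK // app_over.
pose W := toggle_cover V1K cK dK rK.
pose w0 : gvert (cov_graph W) := tw_mk _ _ (app a z) ([ffun=> false], [ffun=> 0%R]).
have : V1 (app a' z) = V1 (app a z).
  rewrite -zE; apply: (toggle_side (V1K := V1K) (cK := cK) (dK := dK) (rK := rK) nfix rP (a := b) (app_over a zx)).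
  rewrite -/W -/w0 /b app_comp; last exact: (app_over a zx).
  pose w := appc (nat_iso_inv a) W w0.
  have wx : mvert W w = x by apply: app_over; exact: (app_over a zx).
  have w0fix g : g \in K -> eact_v g (w0 : gvert (cov_graph W)) = w0.
    move=> Kg; rewrite /w0 eact_tw_mk yfix //; congr tw_mk; congr pair.
    by apply/ffunP => i; rewrite !ffunE.
  have wfix g : g \in K -> sact al (Z := W) g w = w.
    move=> Kg; apply: (app_inj (a := a)) => //; first exact: sact_over.
    by rewrite (tfix_sact (Z := W) aK Kg Kg wx) /w app_Kinv ?w0fix //; exact: (app_over a zx).
  by move=> g Kg; rewrite -/w -(tfix_sact (Z := W) a'K Kg Kg wx) wfix.
by rewrite /V1 (asboolF nj) asboolT //; exact: rst_refl.
Qed.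
End FixedJoined.

(** * Pairs of maximal subgroups with large intersection *)

(** When no maximal subgroup is normal, as in a non-abelian simple group, each of them
    is its own normalizer and has other conjugates. The number [u] bounds the orders
    of the intersections of two distinct maximal subgroups, so that a subgroup of
    larger order lies in at most one of them. *)
Section MaximalSubgroups.
Variables (gT : finGroupType) (K : {group gT}).
Hypothesis nmaxK : forall N : {group gT}, maximal N K -> ~~ (N <| K).
Implicit Types M L U H : {group gT}.

Lemma maximal_conj M g : maximal M K -> g \in K -> maximal (M :^ g) K.
Proof. by move=> maxM Kg; rewrite -(conjGid Kg) maximalJ. Qed.

Lemma maximal_norm M : maximal M K -> 'N_K(M) = M.
Proof.
move=> maxM; have /maxgroupP[/properP[sMK _] maxM'] := maxM.
have sMN : M \subset 'N_K(M) by rewrite subsetI sMK normG.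
have [NK|NK] := eqVproper (subsetIl K 'N(M)); last exact: maxM'.
by have := nmaxK maxM; rewrite /normal sMK -{1}NK subsetIr.
Qed.

Lemma maximal_sub_eq M L : maximal M K -> maximal L K -> M \subset L -> M :=: L.
Proof.
move=> /maxgroupP[_ maxM] /maxgroupP[pL _] sML; exact/esym/maxM.
Qed.

Variable u : nat.
Hypothesis maxu : forall M L, maximal M K -> maximal L K -> M :!=: L -> #|M :&: L| <= u.

Lemma maximal_meet M L H : maximal M K -> maximal L K -> H \subset M -> H \subset L ->
  u < #|H| -> M :=: L.
Proof.
move=> maxM maxL sHM sHL uH; apply/eqP; apply: contraTT uH => nML.
rewrite -leqNgt; apply: leq_trans (maxu maxM maxL nML).
by apply: subset_leq_card; rewrite subsetI sHM.
Qed.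

Section NormalMeet.
Variable U : {group gT}.
Hypotheses (nUK : U <| K) (uU : #|U| = u).

(** Two conjugates of [M] that share an element outside [U] share a subgroup larger than
    [U], hence are equal; and [M] is its own normalizer. *)
Lemma maximal_TI M : maximal M K -> U \subset M -> normedTI (M :\: U) K M.
Proof.
move=> maxM sUM; have /maxgroupP[/properP[sMK _] _] := maxM.
have [_ nUK'] := andP nUK.
apply/normedTI_P; split.
- apply/set0Pn; have [MU|[m Mm nUm]] : M :=: U \/ exists2 m, m \in M & m \notin U.
  + have [sMU|/subsetPn[m Mm nUm]] := boolP (M \subset U); last by right; exists m.
    by left; apply/eqP; rewrite eqEsubset sMU.
  + by have := nmaxK maxM; rewrite MU nUK.
  + by exists m; rewrite inE nUm.
- rewrite subsetI sMK; apply/normsP => m Mm; rewrite conjDg conjGid //.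
  by rewrite (normP (subsetP nUK' m (subsetP sMK m Mm))).
move=> g Kg; rewrite -setI_eq0 => /set0Pn[h]; rewrite conjDg !inE.
rewrite (normP (subsetP nUK' g Kg)) => /andP[/andP[nUh Mh] /andP[_ Mgh]].
have maxMg := maximal_conj maxM Kg.
suff MgM : (M :^ g)%G :=: M by rewrite -(maximal_norm maxM) inE Kg /=; apply/normP.
apply: (maximal_meet (H := U <*> <[h]>) maxMg maxM).
- rewrite join_subG cycle_subG Mgh andbT.
  by rewrite -(normP (subsetP nUK' g Kg)) conjSg.
- by rewrite join_subG cycle_subG Mh andbT.
- rewrite -uU; apply: proper_card; rewrite properE joing_subl /=.
  by apply: contra nUh => /subsetP; apply; rewrite mem_gen // inE cycle_id orbT.
Qed.

Lemma maximal_support M : maximal M K -> U \subset M ->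
  (#|class_support (M :\: U) K| + #|K : M| * #|U| = #|K|)%N.
Proof.
move=> maxM sUM; have /maxgroupP[/properP[sMK _] _] := maxM.
rewrite (card_support_normedTI (maximal_TI maxM sUM)) mulnC -mulnDr.
by rewrite addnC -{1}(setIidPr sUM) cardsID mulnC Lagrange.
Qed.

Lemma maximal_index2 M : maximal M K -> U \subset M ->
  (2 * (#|K : M| * #|U|) <= #|K|)%N.
Proof.
move=> maxM sUM; have /maxgroupP[/properP[sMK _] _] := maxM.
rewrite mulnCA mulnC -(Lagrange sMK) leq_mul2r; apply/orP; right.
rewrite -(Lagrange sUM) mulnC leq_mul2l; apply/orP; right.
rewrite ltn_neqAle eq_sym indexg_gt0 andbT.
apply: contraTneq isT => /eqP; rewrite indexg_eq1 => sMU.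
have /eqP MU : M == U :> {set gT} by rewrite eqEsubset sMU.
by have := nmaxK maxM; rewrite MU nUK.
Qed.

(** If the largest intersection [U] were normal, the maximal subgroups containing [U]
    would meet pairwise in [U], and the conjugates of each would contain more than
    half of the elements of [K] outside [U], leaving no room for a second conjugacy
    class. But the conjugates of [M] do not cover [K], and an element outside them
    lies in another maximal subgroup containing [U], unless [K / U] is cyclic and [M]
    normal. *)
Lemma maximal_meet_not_normal M : maximal M K -> U \subset M -> False.
Proof.
move=> maxM sUM; have /maxgroupP[/properP[sMK [k0 Kk0 nMk0]] _] := maxM.
have [sUK nUK'] := andP nUK.
have lt1 : (1 < #|K : M|)%N.
  by rewrite ltn_neqAle eq_sym indexg_gt0 andbT indexg_eq1; apply/subsetPn; exists k0.
have supK H : H \subset K -> class_support (H :\: U) K \subset K :\: U.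
  move=> sHK; apply/subsetP => _ /imset2P[h k + Kk ->]; rewrite !inE => /andP[nUh Hh].
  by rewrite memJ_norm ?(subsetP nUK') // nUh groupJ // (subsetP sHK).
have [g Kg nMg] : exists2 g, g \in K :\: U & g \notin class_support (M :\: U) K.
  apply/subsetPn/negP => sKM.
  have := maximal_support maxM sUM; have := subset_leq_card sKM.
  rewrite cardsD (setIidPr sUK) => le1 E.
  have := subset_leq_card sUK; rewrite -E => le2.
  move: le1; rewrite -E leq_subLR [(#|U| + _)%N]addnC leq_add2l leqNgt.
  by rewrite -{1}[#|U|]mul1n ltn_mul2r lt1 cardG_gt0.
have [Kg' nUg] : g \in K /\ g \notin U by move: Kg; rewrite inE => /andP[].
have sUgK : U <*> <[g]> \subset K by rewrite join_subG sUK cycle_subG.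
have [UgK|[L maxL sUgL]] := maximal_exists sUgK.
- have abK : abelian (K / U).
    rewrite -UgK /= quotientYidl ?cycle_subG ?(subsetP nUK') //.
    by rewrite quotient_cycle ?(subsetP nUK') // cycle_abelian.
  have := nmaxK maxM; rewrite (sub_der1_normal _ sMK) //.
  by apply: subset_trans sUM; apply: der1_min.
have [sUL Lg] : U \subset L /\ g \in L.
  by move: sUgL; rewrite join_subG cycle_subG => /andP[].
have dis : [disjoint class_support (M :\: U) K & class_support (L :\: U) K].
  rewrite -setI_eq0; apply/eqP/setP => y; rewrite !inE; apply/negP => /andP[].
  case/imset2P=> m a; rewrite inE => /andP[nUm Mm] Ka ->.
  case/imset2P=> l b; rewrite inE => /andP[nUl Ll] Kb E.
  have MaLb : (M :^ a)%G :=: (L :^ b)%G.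
    apply: (maximal_meet (H := U <*> <[m ^ a]>)); rewrite ?maximal_conj //.
    - rewrite join_subG cycle_subG memJ_conjg Mm andbT.
      by rewrite -(normP (subsetP nUK' a Ka)) conjSg.
    - rewrite join_subG cycle_subG E memJ_conjg Ll andbT.
      by rewrite -(normP (subsetP nUK' b Kb)) conjSg.
    - rewrite -uU; apply: proper_card; rewrite properE joing_subl /=.
      apply: contra nUm => /subsetP/(_ (m ^ a)) mU.
      rewrite -(memJ_norm m (subsetP nUK' a Ka)); apply: mU.
      by rewrite mem_gen // inE cycle_id orbT.
  have LM : L :=: M :^ (a * b^-1) by rewrite conjsgM /= MaLb conjsgK.
  move/negP: nMg; apply; apply/imset2P; exists (g ^ (b * a^-1)) (a * b^-1).
  - have nb : b * a^-1 \in 'N(U) by rewrite (subsetP nUK') ?groupM ?groupV.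
    rewrite in_setD (memJ_norm g nb) (negbTE nUg) /=.
    by rewrite -(memJ_conjg _ (a * b^-1)) -LM -conjgM !mulgA mulgKV mulgV conjg1.
  - by rewrite groupM ?groupV.
  - by rewrite -conjgM !mulgA mulgKV mulgV conjg1.
have sub : class_support (M :\: U) K :|: class_support (L :\: U) K \subset K :\: U.
  by rewrite subUset !supK //; case/maxgroupP: maxL => /properP[].
have := subset_leq_card sub; rewrite cardsU (disjoint_setI0 dis) cards0 subn0.
rewrite cardsD (setIidPr sUK).
have EM := maximal_support maxM sUM; have EL := maximal_support maxL sUL.
have IM := maximal_index2 maxM sUM; have IL := maximal_index2 maxL sUL.
have U0 := cardG_gt0 U; have K0 := cardG_gt0 K; move: EM EL IM IL U0 K0.
move: #|class_support _ _| #|class_support _ _| (#|K : M| * #|U|)%N (#|K : L| * #|U|)%N.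
move: #|K| #|U| => k w cM cL iM iL; clear; lia.
Qed.
End NormalMeet.
End MaximalSubgroups.

(** The largest intersection is not normal, so its normalizer lies in a maximal
    subgroup, which contains the intersection as well and can be taken as one of the
    two. *)
Lemma maximal_pair (gT : finGroupType) (K : {group gT}) : K :!=: 1 ->
  (forall N : {group gT}, maximal N K -> ~~ (N <| K)) ->
  exists M L : {group gT}, [/\ maximal M K, maximal L K, 'N_K(M :&: L) \subset M,
    M :!=: L & forall M' L' : {group gT}, maximal M' K -> maximal L' K ->
      M' :!=: L' -> #|M' :&: L'| <= #|M :&: L|].
Proof.
move=> ntK nmax.
have [M0 maxM0 _] : exists2 M : {group gT}, maximal M K & 1%G \subset M.
  have [E|//] := @maximal_exists _ 1%G K (sub1G _).
  by rewrite -E eqxx in ntK.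
pose P (p : {group gT} * {group gT}) :=
  [&& maximal p.1 K, maximal p.2 K & p.1 :!=: p.2].
have [k Kk nk] : exists2 k, k \in K & M0 :^ k != M0.
  have := nmax _ maxM0; rewrite /normal; have /maxgroupP[/properP[-> _] _] := maxM0.
  move/subsetPn=> [k Kk nk]; exists k => //; apply: contra nk => /eqP E; exact/normP.
have P0 : P (M0, (M0 :^ k)%G).
  by rewrite /P /= maxM0 maximal_conj // eq_sym.
case: (@arg_maxnP _ (M0, (M0 :^ k)%G) P (fun p => #|p.1 :&: p.2|) P0).
case=> M L /and3P[/= maxM maxL nML] maxP.
have maxu (M' L' : {group gT}) : maximal M' K -> maximal L' K -> M' :!=: L' -> #|M' :&: L'| <= #|M :&: L|.
  by move=> m1 m2 m3; have := maxP (M', L'); rewrite /P /= m1 m2 m3; apply.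
have sUK : M :&: L \subset K.
  by apply: subset_trans (subsetIl _ _) _; case/maxgroupP: maxM => /properP[].
have [NK|[M1 maxM1 sNM1]] := @maximal_exists _ 'N_K(M :&: L)%G K (subsetIl _ _).
  have nU : (M :&: L)%G <| K by rewrite /normal sUK -{1}NK subsetIr.
  by case: (maximal_meet_not_normal nmax maxu nU erefl maxM (subsetIl _ _)).
have sUM1 : M :&: L \subset M1.
  by apply: subset_trans sNM1; rewrite subsetI sUK normG.
have [L1 [maxL1 nL1 sUL1]] : exists L1 : {group gT},
    [/\ maximal L1 K, M1 :!=: L1 & M :&: L \subset L1].
  have [E|nM1] := eqVneq (M1 : {set gT}) M; last by exists M; rewrite subsetIl.
  by exists L; rewrite E nML subsetIr.
have UE : M1 :&: L1 = M :&: L.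
  by apply/esym/eqP; rewrite eqEcard subsetI sUM1 sUL1 maxu.
by exists M1, L1; rewrite UE.
Qed.

(** * Stabilizers and translation coverings *)

Section Stabilizers.
Variables (G : finGroupType) (X : graph) (A : graph_action G X) (K : {group G}).
Variable Z : ecover A K.

Definition vstab_set (z : gvert (cov_graph Z)) : {set G} :=
  [set g in K | `[< eact_v g z = z >]]%SET.

Lemma vstab_group_set z : group_set (vstab_set z).
Proof.
apply/group_setP; split=> [|g k].
  by rewrite inE group1; apply/asboolP; exact: eact_v1.
rewrite !inE => /andP[Kg /asboolP gz] /andP[Kk /asboolP kz]; rewrite groupM //.
by apply/asboolP; rewrite eact_vM // kz.
Qed.
Canonical vstab z : {group G} := Group (vstab_group_set z).

Definition estab_set (e : gedge (cov_graph Z)) : {set G} :=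
  [set g in K | `[< eact_e g e = e >]]%SET.

Lemma estab_group_set e : group_set (estab_set e).
Proof.
apply/group_setP; split=> [|g k].
  by rewrite inE group1; apply/asboolP; exact: eact_e1.
rewrite !inE => /andP[Kg /asboolP ge] /andP[Kk /asboolP ke]; rewrite groupM //.
by apply/asboolP; rewrite eact_eM // ke.
Qed.
Canonical estab e : {group G} := Group (estab_group_set e).

Lemma vstabP g z : g \in K -> reflect (eact_v g z = z) (g \in vstab z).
Proof. by move=> Kg; rewrite inE Kg; exact: asboolP. Qed.

Lemma vstab_act g z : g \in vstab z -> eact_v g z = z.
Proof. by rewrite inE => /andP[_ /asboolP]. Qed.

Lemma estabP g e : g \in K -> reflect (eact_e g e = e) (g \in estab e).
Proof. by move=> Kg; rewrite inE Kg; exact: asboolP. Qed.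

Lemma vstab_sub z : vstab z \subset K.
Proof. by apply/subsetP => g; rewrite inE => /andP[]. Qed.

Lemma vstab_conj k z : k \in K -> vstab (eact_v k z) = vstab z :^ k^-1 :> {set G}.
Proof.
move=> Kk; apply/setP => g; rewrite mem_conjgV.
have [Kg|nKg] := boolP (g \in K); last first.
  rewrite !inE (negbTE nKg) (_ : (g ^ k \in K) = false) //.
  by rewrite groupJr // (negbTE nKg).
have Kgk : g ^ k \in K by rewrite groupJ.
apply/(vstabP _ Kg)/(vstabP _ Kgk).
- move=> E; apply: (can_inj (fun z => eact_vK z Kk)).
  by rewrite -eact_vM // conjgE !mulgA mulgV mul1g eact_vM.
- move/(congr1 (eact_v k)); rewrite -!eact_vM // conjgE !mulgA mulgV mul1g.
by [].
Qed.

Lemma estab_conj k e : k \in K -> estab (eact_e k e) = estab e :^ k^-1 :> {set G}.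
Proof.
move=> Kk; apply/setP => g; rewrite mem_conjgV.
have [Kg|nKg] := boolP (g \in K); last first.
  rewrite !inE (negbTE nKg) (_ : (g ^ k \in K) = false) //.
  by rewrite groupJr // (negbTE nKg).
have Kgk : g ^ k \in K by rewrite groupJ.
apply/(estabP _ Kg)/(estabP _ Kgk).
- move=> E; apply: (can_inj (fun e => eact_eK e Kk)).
  by rewrite -eact_eM // conjgE !mulgA mulgV mul1g eact_eM.
- move/(congr1 (eact_e k)); rewrite -!eact_eM // conjgE !mulgA mulgV mul1g.
by [].
Qed.

Lemma estab_src e : estab e \subset vstab (gsrc e).
Proof.
apply/subsetP => g; rewrite !inE => /andP[Kg /asboolP ge]; rewrite Kg.
by apply/asboolP; rewrite eact_src // ge.
Qed.

Lemma estab_tgt e : estab e \subset vstab (gtgt e).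
Proof.
apply/subsetP => g; rewrite !inE => /andP[Kg /asboolP ge]; rewrite Kg.
by apply/asboolP; rewrite eact_tgt // ge.
Qed.
End Stabilizers.

(** This makes functions with values in a finite abelian group a [finZmodType], as
    required of the states of a translation covering. *)
HB.instance Definition _ (aT : finType) (rT : finZmodType) :=
  GRing.Zmodule.on {ffun aT -> rT}.

(** When the change of state along [e] is the translation by [t e], all translations of
    the state are automorphisms of the covering, see [app_trD], and the section acts on
    the states over a fixed vertex by affine maps, whose translation parts form a
    1-cocycle of [K] with values in the group of states. *)
Section TranslationCover.
Variables (G : finGroupType) (X : graph) (A : graph_action G X) (K : {group G}).
Variables (B : ecover A K) (D : finZmodType) (t : gedge (cov_graph B) -> D).
Variable rho : G -> D -> D.
Hypothesis rho1 : forall d, rho 1 d = d.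
Hypothesis rhoM : forall g k d, rho (g * k) d = rho g (rho k d).
Hypothesis rhoD : forall g d d', rho g (d + d')%R = (rho g d + rho g d')%R.
Hypothesis rho_t : forall g e, g \in K -> t (eact_e g e) = rho g (t e).

Definition shift e (d : D) : D := (d + t e)%R.
Definition unshift e (d : D) : D := (d - t e)%R.
Lemma shiftK e : cancel (shift e) (unshift e).
Proof. by move=> d; rewrite /shift /unshift GRing.addrK. Qed.
Lemma unshiftK e : cancel (unshift e) (shift e).
Proof. by move=> d; rewrite /shift /unshift GRing.subrK. Qed.

Lemma rho_shift g e d : g \in K -> rho g (shift e d) = shift (eact_e g e) (rho g d).
Proof. by move=> Kg; rewrite /shift rhoD rho_t. Qed.

Definition tr_cover : ecover A K :=
  tw_ecover shiftK unshiftK rho1 (fun g k d _ _ => rhoM g k d) rho_shift.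

Definition tr_mk (z : gvert (cov_graph B)) (d : D) : gvert (cov_graph tr_cover) :=
  tw_mk shiftK unshiftK z d.
Definition tr_base (z : gvert (cov_graph tr_cover)) : gvert (cov_graph B) :=
  tw_base (tauK := shiftK) (tauK' := unshiftK) z.
Definition tr_val (z : gvert (cov_graph tr_cover)) : D :=
  tw_val (tauK := shiftK) (tauK' := unshiftK) z.

Lemma tr_eta z : tr_mk (tr_base z) (tr_val z) = z. Proof. exact: tw_eta. Qed.
Lemma tr_mkK z d : tr_val (tr_mk z d) = d. Proof. exact: tw_mkK. Qed.

Lemma eact_tr_mk g z d : eact_v g (tr_mk z d) = tr_mk (eact_v g z) (rho g d).
Proof. exact: eact_tw_mk. Qed.

Lemma tr_joined z z' : joined z z' -> joined (tr_base z) (tr_base z').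
Proof.
elim=> {z z'} [z z' [e [<- <-]]|z|z z' _ IH|z y z' _ IH1 _ IH2].
- by apply: rst_step; exists e.1.
- exact: rst_refl.
- exact: rst_sym.
- exact: rst_trans IH2.
Qed.

Lemma app_tr_base v w (a : nat_iso v w) z :
  mvert B (tr_base z) = v -> tr_base (app a z) = app a (tr_base z).
Proof. exact: app_tw_base. Qed.

Lemma app_trD v w (a : nat_iso v w) z d d' : mvert B z = v ->
  appc a tr_cover (tr_mk z (d + d')%R) =
  tr_mk (appc a B z) (tr_val (appc a tr_cover (tr_mk z d)) + d')%R.
Proof.
move=> zv; rewrite -(app_tr_base a (z := tr_mk z d) zv).
apply: (@app_tw_aut X B D shift unshift shiftK unshiftK v w a (fun d => d + d')%R z d _ zv).
by move=> e c; rewrite /shift GRing.addrAC.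
Qed.

Section Affine.
Variables (x : gvert X) (al : forall g, nat_iso (actv A g x) x).
Hypothesis alM : forall g k p (y : gvert (cov_graph p)),
  mvert p y = actv A (g * k) x ->
  appc (al (g * k)) p y = appc (al g) p (appc (al k) (twist A g^-1 p) y).
Variable b : gvert (cov_graph B).
Hypotheses (bx : mvert B b = x) (bfix : forall g, g \in K -> sact al g b = b).

Definition tr_cocycle g : D := tr_val (sact al (Z := tr_cover) g (tr_mk b 0%R)).

Lemma sact_tr g d : g \in K ->
  sact al g (tr_mk b d) = tr_mk b (rho g d + tr_cocycle g)%R.
Proof.
move=> Kg; rewrite /sact eact_tr_mk.
have gx : mvert B (eact_v g b) = actv A g x by rewrite eact_over // bx.
rewrite -[rho g d]GRing.add0r (app_trD _ _ _ gx) -/(sact al g b) bfix //.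
rewrite GRing.add0r GRing.addrC /tr_cocycle /sact eact_tr_mk.
suff -> : rho g 0%R = 0%R by [].
by apply: (GRing.addrI (rho g 0%R)); rewrite -rhoD !GRing.addr0.
Qed.

Lemma tr_cocycleM g k : g \in K -> k \in K ->
  tr_cocycle (g * k) = (rho g (tr_cocycle k) + tr_cocycle g)%R.
Proof.
move=> Kg Kk; have bx' : mvert tr_cover (tr_mk b 0%R) = x by [].
have E := sact_tr 0%R Kk.
rewrite /tr_cocycle (sactM alM Kg Kk bx') -[sact al k _]tr_eta -/(tr_cocycle k).
rewrite E; change (tr_base _) with b; rewrite sact_tr // tr_mkK.
by rewrite tr_mkK.
Qed.

End Affine.
End TranslationCover.

(** * Functions on a group with values in the field of two elements *)

(** These functions form a free module over the group algebra: its first cohomology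
    vanishes, see [ltrans_cobord], and the number of its invariants under a subgroup is
    determined by the index, see [card_linv]. *)
Section InvariantFunctions.
Variables (gT : finGroupType).
Let D := {ffun gT -> 'Z_2}.

Definition ltrans (g : gT) (d : D) : D := [ffun h => d (g^-1 * h)].

Lemma ltrans1 d : ltrans 1 d = d.
Proof. by apply/ffunP => h; rewrite ffunE invg1 mul1g. Qed.

Lemma ltransM g k d : ltrans (g * k) d = ltrans g (ltrans k d).
Proof. by apply/ffunP => h; rewrite !ffunE invMg mulgA. Qed.

Lemma ltransD g d d' : ltrans g (d + d')%R = (ltrans g d + ltrans g d')%R.
Proof. by apply/ffunP => h; rewrite !ffunE. Qed.

Lemma ltransN g d : ltrans g (- d)%R = (- ltrans g d)%R.
Proof. by apply/ffunP => h; rewrite !ffunE. Qed.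

Definition linv (H : {set gT}) : {set D} := [set d | [forall h in H, ltrans h d == d]]%SET.

Lemma linvP (H : {set gT}) d : reflect (forall h, h \in H -> ltrans h d = d) (d \in linv H).
Proof. by rewrite inE; apply: (iffP forall_inP) => h k /h /eqP. Qed.

Lemma card_linv (H : {group gT}) : #|linv H| = (2 ^ #|[set: gT] : H|)%N.
Proof.
pose R := rcosets H [set: gT].
pose phi (d : D) : {ffun {set gT} -> 'Z_2} := [ffun C => if C \in R then d (repr C) else 0%R].
have dE d g : d \in linv H -> d g = d (repr (H :* g)).
  move/linvP=> dH; have [h Hh] := repr_rcosetP H g.
  by transitivity (ltrans h d (h * g)); [rewrite ffunE mulKg | rewrite dH].
have gR g : H :* g \in R by apply/rcosetsP; exists g; rewrite ?inE.
have phiI : {in linv H &, injective phi}.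
  move=> d d' Hd Hd' /ffunP E; apply/ffunP => g.
  by have := E (H :* g); rewrite !ffunE gR -!dE.
rewrite -(card_in_imset phiI) /indexg -/R.
have E2 : #|('Z_2 : predArgType)| = 2%N by rewrite card_ord.
rewrite -[in RHS]E2 -(card_pffun_on 0%R (mem R) predT); apply: eq_card => F.
apply/imsetP/pffun_onP => [[d Hd ->]|[supF _]].
  split; last by move=> y _.
  by apply/supportP => C nRC; rewrite ffunE (negbTE nRC).
exists [ffun g => F (H :* g)].
  apply/linvP => h Hh; apply/ffunP => g; rewrite !ffunE.
  by congr (F _); rewrite rcosetM (rcoset_id (groupVr Hh)).
apply/ffunP => C; rewrite !ffunE; case: ifPn => [|nRC].
  by case/rcosetsP=> g _ ->; rewrite rcoset_repr.
by move/supportP: supF => /(_ C nRC).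
Qed.

(** For the whole group [G], the hypotheses give [#|G : M| <= #|G : U| / 2] and [#|G :
    L| <= #|G : U| / 3]; since 1/2 + 1/3 < 1, there are fewer differences [d' - d]
    than functions [a]. *)
Lemma linv_not_sum (M L U : {group gT}) : U \subset M -> U \subset L ->
  (1 < #|M : U|)%N -> (2 < #|L : U|)%N ->
  exists2 a, a \in linv U & forall d d', d \in linv M -> d' \in linv L -> a <> (d' - d)%R.
Proof.
move=> sUM sUL iM iL; apply: contrapT => H.
have sub : linv U \subset [set p.2 - p.1 | p in setX (linv M) (linv L)]%R%SET.
  apply/subsetP => a Ua; apply: contrapT => na; apply: H; exists a => // d d' Md Ld' E.
  by apply: na; apply/imsetP; exists (d, d'); [rewrite in_setX Md | exact: E].
have := leq_trans (subset_leq_card sub) (leq_imset_card _ _).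
rewrite cardsX !card_linv -expnD leq_exp2l //.
have EM := Lagrange_index (subsetT M) sUM; have EL := Lagrange_index (subsetT L) sUL.
have M2 : (#|[set: gT] : M| * 2 <= #|[set: gT] : U|)%N by rewrite -EM leq_mul2l iM orbT.
have L3 : (#|[set: gT] : L| * 3 <= #|[set: gT] : U|)%N by rewrite -EL leq_mul2l iL orbT.
have := indexg_gt0 [set: gT] M; move: M2 L3.
move: #|_ : M| #|_ : L| #|_ : U| => i j k; clear; lia.
Qed.

(** As [K] acts freely on the group, the cocycle [c] is split by evaluating it, at the
    point [h], on the element of [K] that takes the representative of the orbit of [h]
    to [h] itself. *)
Lemma ltrans_cobord (K : {group gT}) (c : gT -> D) :
  (forall g k, g \in K -> k \in K -> c (g * k) = (ltrans g (c k) + c g)%R) ->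
  exists f : D, forall g, g \in K -> (ltrans g f + c g)%R = f.
Proof.
move=> cM; have c1 : c 1 = 0%R.
  have := cM 1 1 (group1 K) (group1 K); rewrite mulg1 ltrans1.
  by rewrite -{1}[c 1]GRing.addr0 => /GRing.addrI.
exists [ffun h => c (h * (repr (K :* h))^-1) h] => g Kg; apply/ffunP => h; rewrite !ffunE.
have -> : K :* (g^-1 * h) = K :* h by rewrite rcosetM (rcoset_id (groupVr Kg)).
set j := h * _; have Kj : j \in K.
  by rewrite -groupV /j invMg invgK -mem_rcoset mem_repr_rcoset.
rewrite -mulgA -/j cM ?groupV // !ffunE invgK mulKVg.
have := cM g g^-1 Kg (groupVr Kg); rewrite mulgV c1 => /ffunP/(_ h).
rewrite !ffunE -GRing.addrA => <-; by rewrite GRing.addr0.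
Qed.
End InvariantFunctions.

(** * A fixed point of the section forces a fixed vertex: normal maximal subgroups *)

(** The point [b] in the fiber of [B] at [x] is fixed under the action of the section.
    By [nofix] no vertex in its component is fixed by [K], while [IH] provides vertices
    of the universal pro-finite covering fixed by the proper subgroups of [K]; their
    images lie in this component.  This will be contradicted. *)
Section FixedVertex.
Variables (G : finGroupType) (X : graph) (A : graph_action G X).
Hypothesis Xfin : finite_graph X.
Variables (x : gvert X) (al : forall g, nat_iso (actv A g x) x).
Hypothesis alM : forall g k p (y : gvert (cov_graph p)),
  mvert p y = actv A (g * k) x ->
  appc (al (g * k)) p y = appc (al g) p (appc (al k) (twist A g^-1 p) y).
Variable K : {group G}.
Hypothesis IH : forall H : {group G}, H \proper K ->
  exists v (a : nat_iso x v), tfix al H a.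
Variables (B : ecover A K) (b : gvert (cov_graph B)).
Hypotheses (bx : mvert B b = x) (bfix : forall g, g \in K -> sact al g b = b).
Hypothesis nofix : forall c, joined b c -> vstab c \proper K.

Lemma tfix_vstab (H : {group G}) v (a : nat_iso x v) : H \subset K -> tfix al H a ->
  H \subset vstab (appc a B b).
Proof.
move=> sHK aH; apply/subsetP => h Hh; have Kh := subsetP sHK h Hh.
by apply/vstabP => //; rewrite -(tfix_sact aH Hh Kh bx) bfix.
Qed.

Section NormalMaximal.
Variable N : {group G}.
Hypotheses (maxN : maximal N K) (nNK : N <| K).

(** The quotient of [K] by [N] is cyclic of order [m], generated by the class of some
    [k0]. Since no vertex of the component is fixed by [K], its [N]-fixed vertices
    have stabilizer [N], so that each can be written as [h r] for its orbit
    representative [r], where [h] is unique modulo [N]. Let an edge between two of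
    them carry as weight the change of [h], as an element of the integers modulo [m],
    lifted to the integers modulo [m * m], and let all other edges have weight 0. In
    the resulting translation covering the section acts over [b] by a homomorphism [c]
    from [K] to the group of order [m * m] that vanishes on [N], whence [m] divides [c
    k0]. But a vertex [a] fixed by [N] and its translate by [k0] are joined by
    [N]-fixed edges, along which the weights add up to the change of [h] modulo [m];
    this gives that [k0] is in [N]. *)
Lemma normal_maximal_absurd : False.
Proof.
have /maxgroupP[pNK maxN'] := maxN; have sNK := proper_sub pNK.
have nNK' : K \subset 'N(N) := normal_norm nNK.
have [vN [a aN]] := IH pNK.
have [k0 Kk0 nNk0] : exists2 k, k \in K & k \notin N by apply/subsetPn; case/properP: pNK => _ [k Kk nk]; apply/subsetPn; exists k.
pose k0' := coset N k0; pose m := #[k0'].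
have stabN c : joined b c -> N \subset vstab c -> vstab c = N :> {set G}.
  by move=> /nofix pc sc; apply: maxN'.
have m1 : (1 < m)%N.
  rewrite ltn_neqAle eq_sym order_gt0 andbT order_eq1.
  apply: contra nNk0 => /eqP/(coset_idr (subsetP nNK' k0 Kk0)); exact.
have m2 : (1 < m * m)%N by nia.
have KN k : k \in K -> exists i : 'I_m, coset N k == k0' ^+ i.
  move=> Kk; have NkK : N * <[k0]> = K.
    by apply: mulg_normal_maximal; rewrite // cycle_subG.
  have : coset N k \in <[k0']>.
    move: Kk; rewrite -{1}NkK => /mulsgP[n _ Nn /cycleP[i ->] ->].
    have nk0 := subsetP nNK' k0 Kk0.
    have nn := subsetP (normG N) n Nn.
    by rewrite morphM ?groupX //= coset_id // mul1g morphX //= mem_cycle.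
  case/cyclePmin=> i lt_i ->; by exists (Ordinal lt_i).
pose J (C : coset_of N) : nat := odflt (Ordinal (ltnW m1)) [pick i : 'I_m | C == k0' ^+ i].
have JP k : k \in K -> coset N k = k0' ^+ J (coset N k).
  move=> Kk; rewrite /J; case: pickP => [i /eqP //|H].
  by have [i] := KN k Kk; rewrite H.
have JM k l : k \in K -> l \in K ->
    J (coset N (k * l)) = J (coset N k) + J (coset N l) %[mod m].
  move=> Kk Kl; apply/eqP; rewrite -eq_expg_mod_order -JP ?groupM //.
  by rewrite expgD -!JP // morphM ?(subsetP nNK').
have [r [rP rK]] := orbit_reps (@eact_v1 _ _ _ _ B) (@eact_vM _ _ _ _ B).
have hex (u : gvert (cov_graph B)) : exists g, g \in K /\ u = eact_v g (r u).
  by have [g Kg ->] := rP u; exists g^-1; rewrite groupV eact_vK.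
have [h hP] := choice hex.
have hK u := (hP u).1; have hE u := (hP u).2.
(* Modulo [N], which is the stabilizer of the representative, [h] is equivariant. *)
have hM k u : k \in K -> vstab u = N :> {set G} ->
    coset N (h (eact_v k u)) = coset N (k * h u).
  move=> Kk uN.
  have Kku : k * h u \in K by rewrite groupM ?hK.
  have Nn : (k * h u)^-1 * h (eact_v k u) \in N.
    have rN : vstab (r u) = N :> {set G}.
      have [g Kg ->] := rP u; rewrite vstab_conj // uN.
      by apply/normP; rewrite groupV (subsetP nNK').
    rewrite -rN; apply/vstabP; first by rewrite groupM ?groupV ?hK.
    rewrite eact_vM ?groupV ?hK //; apply: (can_inj (fun z => eact_vK z Kku)).
    rewrite eact_vKV // eact_vM ?hK // -hE.
    by have := hE (eact_v k u); rewrite rK.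
  rewrite -[h (eact_v k u)](mulKVg (k * h u)) morphM ?(subsetP nNK') ?groupM ?groupV ?hK //.
  by rewrite [X in _ * X]coset_id // mulg1.
pose t (e : gedge (cov_graph B)) : 'Z_(m * m) :=
  if (vstab (gsrc e) == N :> {set G}) && (vstab (gtgt e) == N :> {set G})
  then ((J (coset N ((h (gsrc e))^-1 * h (gtgt e))))%:R)%R else 0%R.
have NJ l (V : {group G}) : l \in K -> (V :^ l^-1 == N) = (V == N :> {set G}).
  move=> Kl; rewrite -{1}(normP (subsetP nNK' _ (groupVr Kl))).
  by rewrite (inj_eq (@conjsg_inj _ _)).
have t_inv (g : G) e : g \in K -> t (eact_e g e) = t e.
  move=> Kg; rewrite /t -eact_src // -eact_tgt // !vstab_conj // !NJ //.
  case: ifP => // /andP[/eqP sN /eqP tN].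
  have nK l : l \in K -> l \in 'N(N) by exact: (subsetP nNK' l).
  rewrite !morphM ?morphV ?nK ?groupV ?hK //= !hM // -!morphV ?nK ?groupM //=.
  rewrite -!morphM ?nK ?groupM ?groupV //= ?groupM //.
  by rewrite invMg !mulgA mulgKV.
pose D : finZmodType := 'Z_(m * m).
pose rho (g : G) (d : D) : D := d.
have rho1 d : rho 1 d = d by [].
have rhoM g k d : rho (g * k) d = rho g (rho k d) by [].
have rhoD g d d' : rho g (d + d')%R = (rho g d + rho g d')%R by [].
have rho_t g e : g \in K -> t (eact_e g e) = rho g (t e) by exact: t_inv.
pose P := tr_cover rho1 rhoM rhoD rho_t.
pose mk z d : gvert (cov_graph P) := tr_mk rho1 rhoM rhoD rho_t z d.
pose vl (z : gvert (cov_graph P)) : D := tr_val (rho1 := rho1) (rhoM := rhoM) (rhoD := rhoD) (rho_t := rho_t) z.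
pose c (g : G) : D := tr_cocycle rho1 rhoM rhoD rho_t al b g.
have sactE g (d : D) : g \in K -> sact al (Z := P) g (mk b d) = mk b (d + c g)%R.
  by move=> Kg; exact: (sact_tr _ _ _ _ bx bfix).
have cM g k : g \in K -> k \in K -> c (g * k) = (c k + c g)%R.
  by move=> Kg Kk; exact: (tr_cocycleM _ _ _ _ alM bx bfix).
pose PN := ecover_sub sNK P.
have aE (d : D) : appc a P (mk b d) = mk (appc a B b) (vl (appc a P (mk b 0)) + d)%R.
  by rewrite -{1}[d]GRing.add0r; exact: app_trD.
have cN n : n \in N -> c n = 0%R.
  move=> Nn; have Kn := subsetP sNK n Nn.
  have := @tfix_sact _ _ _ _ al N K P vN a n (mk b 0%R) aN Nn Kn bx.
  rewrite sactE // GRing.add0r [LHS]aE [in RHS]aE.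
  rewrite /mk eact_tr_mk GRing.addr0 (vstab_act (subsetP (tfix_vstab sNK aN) n Nn)).
  move/(congr1 vl); rewrite /vl !tr_mkK.
  by rewrite -[in RHS](GRing.addr0 (tr_val _)) => /GRing.addrI.
have cX i : c (k0 ^+ i) = (c k0 *+ i)%R.
  elim: i => [|i IHi]; first by rewrite expg0 cN ?group1.
  by rewrite expgS cM ?groupX // IHi GRing.mulrSr.
(* [k0 ^+ m] is in [N], hence [m * c k0] vanishes modulo [m * m]. *)
have dvd_c : (m %| c k0)%N.
  have nk0 := subsetP nNK' k0 Kk0.
  have E : ((c k0 * m)%N%:R : 'Z_(m * m))%R = 0%R.
    rewrite GRing.natrM natr_Zp GRing.mulr_natr -cX.
    by apply: cN; apply: coset_idr; rewrite ?groupX // morphX //= expg_order.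
  have : (m * m %| c k0 * m)%N by rewrite /dvdn -(val_Zp_nat m2) E.
  by rewrite (dvdn_pmul2r (ltnW m1)).
(* The points of the product over [b] are fixed by [N], so that the vertex [a] and
   its translate by [k0] send them to the same component of the graph of [N]. *)
have nk0 := subsetP nNK' k0 Kk0.
have aN' : tfix al N (ttrans al k0 a) by exact: tfix_ttrans.
have bfixN g : g \in N -> sact al (Z := PN) g (mk b 0%R) = mk b 0%R.
  move=> Ng; rewrite -[LHS]/(sact al (Z := P) g (mk b 0%R)) sactE ?(subsetP sNK) //.
  by rewrite cN // GRing.addr0.
have J0 := fixed_joined (Z := PN) Xfin aN aN' (z := mk b 0%R) bx bfixN.
pose y := appc a P (mk b 0%R); pose y' := appc (ttrans al k0 a) P (mk b 0%R).
have y'E : y' = mk (eact_v k0 (appc a B b)) (vl y - c k0)%R.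
  rewrite /y'; have -> : mk b 0%R = sact al (Z := P) k0 (mk b (- c k0)%R).
    by rewrite sactE // GRing.addNr.
  by rewrite ttrans_sact // aE /mk eact_tr_mk.
have yE : y = mk (appc a B b) (vl y) by have := aE 0%R; rewrite GRing.addr0.
(* The state modulo [m] minus the class of [h], which the fixed edges preserve. *)
pose kap (z : gvert (cov_graph P)) : nat :=
  ((vl z + J (coset N (h (tr_base z))^-1)) %% m)%N.
have : kap y = kap y'.
  apply: (fjoined_const (Z := PN)) J0 => e efix j.
  have jb : joined b (gsrc e.1).
    have ja : joined (tr_base (y : gvert (cov_graph P))) (gsrc e.1) := tr_joined j.
    rewrite yE in ja.
    exact: rst_trans (app_joined a bx) ja.
  have jb' : joined b (gtgt e.1).
    by apply: rst_trans jb _; apply: rst_step; exists e.1.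
  have sN : N \subset estab e.1.
    apply/subsetP => n Nn; apply/estabP; first exact: (subsetP sNK).
    exact: (congr1 fst (efix n Nn)).
  have eS := stabN _ jb (subset_trans sN (estab_src _)).
  have eT := stabN _ jb' (subset_trans sN (estab_tgt _)).
  have tE : t e.1 = ((J (coset N ((h (gsrc e.1))^-1 * h (gtgt e.1))))%:R)%R.
    by rewrite /t eS eT !eqxx.
  rewrite /kap /vl /tr_val /tr_base /tw_val /tw_base /= encK /shift tE.
  set d := dec _; set j1 := J (coset N (_ * _)).
  rewrite -[in RHS](natr_Zp d) -GRing.natrD (val_Zp_nat m2).
  rewrite -[RHS]modnDml (modn_dvdm _ (dvdn_mulr m (dvdnn m))) modnDml.
  have := JM ((h (gsrc e.1))^-1 * h (gtgt e.1)) (h (gtgt e.1))^-1.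
  rewrite mulgK => JE; rewrite -addnA -[LHS]modnDmr JE ?modnDmr //.
    by rewrite groupM ?groupV ?hK.
  by rewrite groupV hK.
have kE z (d : D) : kap (mk z d) = ((d + J (coset N (h z)^-1)) %% m)%N.
  by rewrite /kap /vl tr_mkK.
set u := appc a B b in y'E yE; have uN : vstab u = N :> {set G}.
  by apply: stabN; [exact: app_joined | exact: tfix_vstab].
have Jk0 : J (coset N (h (eact_v k0 u))^-1)
    = J (coset N (h u)^-1) + J (coset N k0^-1) %[mod m].
  have nK l : l \in K -> l \in 'N(N) by exact: (subsetP nNK' l).
  rewrite -JM ?groupV ?hK // morphV ?nK ?hK //= hM // -morphV ?nK ?groupM ?hK //=.
  by rewrite invMg.
have valc (d : D) : (d : nat) = (d - c k0)%R %[mod m].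
  rewrite -{1}(GRing.subrK (c k0) d); move: (d - c k0)%R => e.
  have -> : (e + c k0)%R = ((e + c k0)%N%:R : 'Z_(m * m))%R.
    by rewrite GRing.natrD !natr_Zp.
  rewrite (val_Zp_nat m2) (modn_dvdm _ (dvdn_mulr m (dvdnn m))).
  by rewrite -modnDmr (eqP dvd_c) addn0.
rewrite y'E {1}yE !kE -modnDml valc modnDml -[RHS]modnDmr Jk0 modnDmr addnA.
rewrite -[X in X %% _ = _]addn0 => /eqP; rewrite eqn_modDl mod0n eq_sym => /eqP Jm.
have := JP k0^-1; rewrite groupV => /(_ Kk0) E.
have : coset N k0^-1 = 1.
  by apply/eqP; rewrite E -[1](expg0 k0') eq_expg_mod_order Jm mod0n.
rewrite morphV // => /eqP; rewrite eq_invg1 => /eqP/(coset_idr nk0).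
exact/negP.
Qed.
End NormalMaximal.
(** * A fixed point of the section forces a fixed vertex: no normal maximal subgroup *)

(** Let [M] and [L] be maximal subgroups with intersection [U] as in [maximal_pair].
    An arbitrary [U]-invariant function [a0] defines a translation covering whose
    edges carry differences of a potential. As the cohomology vanishes, the section
    fixes a point over [b]; the vertices of the universal pro-finite covering fixed by
    [M] and by [L] send it to states that are invariant under [M] and [L],
    respectively. These two vertices are joined by [U]-fixed edges, so that the states
    differ by the difference of the potentials, which is [a0]. But not all [a0] are of
    this form. *)
Section NonNormalMaximal.
Variables M L : {group G}.
Hypothesis nmaxK : forall N : {group G}, maximal N K -> ~~ (N <| K).
Hypotheses (maxM : maximal M K) (maxL : maximal L K) (nML : M :!=: L).
Let U := (M :&: L)%G.
Hypothesis sNUM : 'N_K(U) \subset M.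
Hypothesis maxu : forall M' L' : {group G}, maximal M' K -> maximal L' K ->
  M' :!=: L' -> #|M' :&: L'| <= #|U|.

Let sMK : M \subset K. Proof. by case/maxgroupP: maxM => /properP[]. Qed.
Let sLK : L \subset K. Proof. by case/maxgroupP: maxL => /properP[]. Qed.
Let sUM : U \subset M. Proof. exact: subsetIl. Qed.
Let sUL : U \subset L. Proof. exact: subsetIr. Qed.
Let sUK : U \subset K. Proof. exact: subset_trans sUM sMK. Qed.

Lemma meet_proper_left : (1 < #|M : U|)%N.
Proof.
rewrite ltn_neqAle eq_sym indexg_gt0 andbT indexg_eq1.
apply: contra nML => sMU; apply/eqP; apply: maximal_sub_eq maxM maxL _.
exact: subset_trans sMU sUL.
Qed.

(** A subgroup of index 2 is normal, so [L] would lie in the normalizer of [U]. *)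
Lemma meet_index_right : (2 < #|L : U|)%N.
Proof.
rewrite ltnNge; apply/negP => le2.
have sLM : L \subset M -> False.
  by move=> /(maximal_sub_eq maxL maxM) E; move: (nML); rewrite E eqxx.
have [i1|i2] : #|L : U| = 1%N \/ #|L : U| = 2%N.
  by case: #|_ : _| (indexg_gt0 L U) le2 => [|[|[|]]] // _ _; [left|right].
- apply: sLM; apply: subset_trans sUM; by rewrite -indexg_eq1 i1.
- apply: sLM; apply: subset_trans sNUM; rewrite subsetI sLK /=.
  by apply: normal_norm; apply: index2_normal.
Qed.

Let sLU : U \proper L.
Proof.
rewrite properE sUL; apply/negP; rewrite -indexg_eq1 => /eqP E.
by have := meet_index_right; rewrite E.
Qed.

Variable a0 : {ffun G -> 'Z_2}.
Hypothesis a0U : a0 \in linv U.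

(** The potential at a vertex with stabilizer [W], seen from an edge with stabilizer
    [V]. For [V] equal to [U] it has to be [a0] at the vertices with stabilizer [L]
    and zero at those with stabilizer [M], and it has to be equivariant. That the
    stabilizer of the edge enters makes it possible to have weights only on the edges
    with stabilizer conjugate to [U]. *)
Definition pot (V W : {set G}) : {ffun G -> 'Z_2} :=
  if [pick k in K | [&& V == U :^ k^-1, V \proper W & W \subset L :^ k^-1]] is Some k
  then ltrans k a0 else 0%R.

Let maxJ (H : {group G}) k : maximal H K -> k \in K -> maximal (H :^ k) K.
Proof. exact: maximal_conj. Qed.

(** The element [k] is determined up to [U], which fixes [a0]: the conjugate of [L] is
    the only maximal subgroup containing [W], which is larger than [U], and [L] is its
    own normalizer; moreover [V] determines [k] up to the normalizer of [U], which
    lies in [M]. *)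
Lemma potE k V (W : {group G}) : k \in K -> V = U :^ k^-1 -> V \proper W -> W \subset L :^ k^-1 ->
  pot V W = ltrans k a0.
Proof.
move=> Kk Vk VW Wk; rewrite /pot; case: pickP => [l|/(_ k)]; last first.
  by rewrite Kk Vk eqxx -Vk VW Wk.
case/andP=> Kl /and3P[/eqP Vl _ Wl].
have eqL : (L :^ k^-1)%G :=: (L :^ l^-1)%G.
  apply: (maximal_meet maxu (H := W)); rewrite ?maxJ ?groupV //.
  by rewrite -(cardJg _ k^-1) -Vk proper_card.
have Klk : l^-1 * k \in K by rewrite groupM ?groupV.
have LU : l^-1 * k \in U.
  have NL : l^-1 * k \in L.
    rewrite -(maximal_norm nmaxK maxL) inE Klk; apply/normP.
    by rewrite conjsgM -[L :^ l^-1]eqL /= conjsgKV.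
  have NU : l^-1 * k \in M.
    apply: (subsetP sNUM); rewrite inE Klk; apply/normP.
    by rewrite conjsgM -Vl Vk conjsgKV.
  by rewrite inE NU.
by rewrite -[in RHS](mulKVg l k) ltransM (linvP _ _ a0U _ LU).
Qed.

Lemma pot_conj g V (W : {group G}) : g \in K ->
  pot (V :^ g^-1) (W :^ g^-1) = ltrans g (pot V W).
Proof.
move=> Kg.
have E k : [&& V :^ g^-1 == U :^ (g * k)^-1, V :^ g^-1 \proper W :^ g^-1
    & W :^ g^-1 \subset L :^ (g * k)^-1]
    = [&& V == U :^ k^-1, V \proper W & W \subset L :^ k^-1].
  rewrite invMg !conjsgM conjSg (inj_eq (@conjsg_inj _ _)).
  by rewrite !properE !conjSg.
rewrite {2}/pot; case: pickP => [k /andP[Kk]|H].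
  rewrite -E => /and3P[/eqP Vk VW Wk].
  by rewrite (potE (k := g * k) (W := (W :^ g^-1)%G)) ?groupM // ltransM.
rewrite /pot; case: pickP => [k|_]; last by apply/ffunP => h; rewrite !ffunE.
case/andP=> Kk; have := E (g^-1 * k); rewrite mulKVg => ->.
by have := H (g^-1 * k); rewrite groupM ?groupV //= => ->.
Qed.

(** The stabilizer [E] of an edge with ends of stabilizers [S] and [T], being larger
    than [U], lies in only one maximal subgroup, which therefore contains both [S] and
    [T]. *)
Lemma pot_near (S T E : {group G}) : S \proper K -> T \proper K -> U \proper E ->
  E \subset S -> E \subset T -> pot U S = pot U T.
Proof.
have half (S' T' : {group G}) k : T' \proper K -> U \proper E ->
    E \subset S' -> E \subset T' -> k \in K -> U :==: U :^ k^-1 ->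
    S' \subset L :^ k^-1 -> T' \subset L :^ k^-1.
  move=> pT UE ES ET Kk /eqP Uk SL.
  have [TK|[L' maxL' sTL']] := maximal_exists (proper_sub pT).
    by move: pT; rewrite TK properxx.
  suff <- : L' :=: L :^ k^-1 by [].
  apply: (maximal_meet maxu (H := E) (M := L') (L := (L :^ k^-1)%G)); rewrite ?maxJ ?groupV //.
  - exact: subset_trans ET sTL'.
  - exact: subset_trans ES SL.
  - exact: proper_card.
move=> pS pT UE ES ET; rewrite /pot; congr (if _ is Some k then _ else _).
apply: eq_pick => k /=; rewrite (proper_sub_trans UE ES) (proper_sub_trans UE ET) /=.
apply: andb_id2l => Kk; apply: andb_id2l => Uk.
by apply/idP/idP; [exact: half pT _ ES ET _ _ | exact: half pS _ ET ES _ _].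
Qed.

(** Were [M] in a conjugate of [L] by some [k^-1] normalizing [U], it would be equal
    to it; but [k] lies in [M], so that [M] would be [L]. *)
Lemma pot_left : pot U M = 0%R.
Proof.
rewrite /pot; case: pickP => [k|//]; case/andP=> Kk /and3P[/eqP Uk _ sML].
have Mk : k \in M.
  apply: (subsetP sNUM); rewrite -groupV inE groupV Kk; apply/normP; exact/esym.
have := maximal_sub_eq maxM (maxJ maxL (groupVr Kk)) sML.
rewrite -{1}(conjGid (groupVr Mk)) => /(@conjsg_inj _ _) E.
by move: (nML); rewrite E eqxx.
Qed.

Lemma pot_right : pot U L = a0.
Proof.
by rewrite (@potE 1 U L) ?group1 ?invg1 ?conjsg1 ?sLU // ltrans1.
Qed.

Lemma pot_small (E W : {set G}) : #|E| <> #|U| -> pot E W = 0%R.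
Proof.
move=> nE; rewrite /pot; case: pickP => [k|//].
by case/andP=> Kk /and3P[/eqP Ek _ _]; case: nE; rewrite Ek cardJg.
Qed.

Let t (e : gedge (cov_graph B)) : {ffun G -> 'Z_2} :=
  (pot (estab e) (vstab (gtgt e)) - pot (estab e) (vstab (gsrc e)))%R.

Lemma pot_shift g e : g \in K -> t (eact_e g e) = ltrans g (t e).
Proof.
move=> Kg; rewrite /t -eact_src // -eact_tgt // !estab_conj // !vstab_conj //.
by rewrite !pot_conj // ltransD ltransN.
Qed.

Let P := tr_cover (D := {ffun G -> 'Z_2}) (@ltrans1 G) (@ltransM G) (@ltransD G) pot_shift.

Lemma pot_split : exists d d', [/\ d \in linv M, d' \in linv L & a0 = (d' - d)%R].
Proof.
pose mk z d : gvert (cov_graph P) := tr_mk (@ltrans1 G) (@ltransM G) (@ltransD G) pot_shift z d.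
pose vl (z : gvert (cov_graph P)) : {ffun G -> 'Z_2} :=
  tr_val (rho1 := @ltrans1 G) (rhoM := @ltransM G) (rhoD := @ltransD G) (rho_t := pot_shift) z.
pose bs (z : gvert (cov_graph P)) : gvert (cov_graph B) :=
  tr_base (rho1 := @ltrans1 G) (rhoM := @ltransM G) (rhoD := @ltransD G) (rho_t := pot_shift) z.
pose c (g : G) := tr_cocycle (@ltrans1 G) (@ltransM G) (@ltransD G) pot_shift al b g.
have sactE g d : g \in K -> sact al (Z := P) g (mk b d) = mk b (ltrans g d + c g)%R.
  by move=> Kg; exact: (sact_tr _ _ _ _ bx bfix).
have [f fE] : exists f, forall g, g \in K -> (ltrans g f + c g)%R = f.
  apply: ltrans_cobord => g k Kg Kk; exact: (tr_cocycleM _ _ _ _ alM bx bfix).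
have zfix g : g \in K -> sact al (Z := P) g (mk b f) = mk b f.
  by move=> Kg; rewrite sactE // fE.
have side (H : {group G}) : maximal H K -> exists v (a : nat_iso x v),
    [/\ tfix al H a, vstab (appc a B b) = H :> {set G} & vl (appc a P (mk b f)) \in linv H].
  move=> maxH; have /maxgroupP[pHK maxH'] := maxH; have sHK := proper_sub pHK.
  have [v [a aH]] := IH pHK; exists v, a; split=> //.
    by apply: maxH'; [apply: nofix; exact: (app_joined a bx) | exact: (tfix_vstab sHK aH)].
  apply/linvP => h Hh; have Kh := subsetP sHK h Hh.
  have := @tfix_sact _ _ _ _ al H K P v a h (mk b f) aH Hh Kh bx.
  rewrite zfix // => E; rewrite [in RHS]E.
  rewrite -[appc a P _ in RHS]tr_eta eact_tr_mk /vl tr_mkK.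
  by [].
have [vM [aM [aMfix mM dM]]] := side M maxM.
have [vL [aL [aLfix lL dL]]] := side L maxL.
exists (vl (appc aM P (mk b f))), (vl (appc aL P (mk b f))); split=> //.
have bfixU g : g \in U -> sact al (Z := ecover_sub sUK P) g (mk b f) = mk b f.
  by move=> Ug; exact/zfix/(subsetP sUK).
have J0 := fixed_joined (Z := ecover_sub sUK P) Xfin (tfix_sub sUM aMfix)
  (tfix_sub sUL aLfix) (z := mk b f) bx bfixU.
(* On the edges with stabilizer [U] the state changes as the potential does; on the other
   edges fixed by [U] neither of them changes, the latter by [pot_near]. *)
pose kap (z : gvert (cov_graph P)) := (vl z - pot U (vstab (bs z)))%R.
have bsE v (a : nat_iso x v) : bs (appc a P (mk b f)) = appc a B b by exact: app_tr_base.
have : kap (appc aM P (mk b f)) = kap (appc aL P (mk b f)).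
  apply: (fjoined_const (Z := ecover_sub sUK P)) J0 => e efix j.
  have jb : joined b (gsrc e.1).
    have ja : joined (bs (appc aM P (mk b f))) (gsrc e.1) := tr_joined j.
    rewrite bsE in ja; exact: rst_trans (app_joined aM bx) ja.
  have jb' : joined b (gtgt e.1).
    by apply: rst_trans jb _; apply: rst_step; exists e.1.
  have sUe : U \subset estab e.1.
    apply/subsetP => u Uu; apply/estabP; first exact: (subsetP sUK).
    exact: (congr1 fst (efix u Uu)).
  rewrite /kap /vl /bs /tr_val /tr_base /tw_val /tw_base /= encK /shift /t.
  move: (dec _) => d; have [Ue|Ue] := eqVproper sUe.
    by rewrite -Ue -GRing.addrA [X in (_ = _ + X)%R]GRing.addrAC GRing.subrr GRing.add0r.
  have nE : #|estab e.1| <> #|U| by move=> E; move: (proper_card Ue); rewrite E ltnn.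
  rewrite !(pot_small _ nE) GRing.subr0 GRing.addr0; congr (_ - _)%R.
  by apply: pot_near Ue (estab_src _) (estab_tgt _); apply: nofix.
rewrite /kap !bsE mM lL pot_left pot_right GRing.subr0 => ->.
by rewrite GRing.subKr.
Qed.
End NonNormalMaximal.
End FixedVertex.

(** * Existence of fixed vertices *)

Section Existence.
Variables (G : finGroupType) (X : graph) (A : graph_action G X).
Hypothesis Xfin : finite_graph X.
Variables (x : gvert X) (al : forall g, nat_iso (actv A g x) x).
Hypothesis alM : forall g k p (y : gvert (cov_graph p)),
  mvert p y = actv A (g * k) x ->
  appc (al (g * k)) p y = appc (al g) p (appc (al k) (twist A g^-1 p) y).

(** A component that contains a fixed point of the section has a vertex fixed by [K],
    the universal pro-finite covering having one for each proper subgroup. *)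
Lemma fixed_vertex (K : {group G}) (B : ecover A K) (b : gvert (cov_graph B)) :
  (forall H : {group G}, H \proper K -> exists v (a : nat_iso x v), tfix al H a) ->
  mvert B b = x -> (forall g, g \in K -> sact al g b = b) ->
  exists2 c, joined b c & vfixed (Z := B) c.
Proof.
move=> IH bx bfix; apply: contrapT => nofix'.
have nofix c : joined b c -> vstab c \proper K.
  move=> bc; rewrite properEneq vstab_sub andbT; apply/negP => /eqP cK.
  apply: nofix'; exists c => // g; rewrite -{1}cK; exact: vstab_act.
have K1 : K :!=: 1.
  apply/eqP => K1; have := nofix b (rst_refl _ _ _).
  by rewrite properE K1 sub1G andbF.
have [[N [maxN nN]]|nmax] := pselect (exists N : {group G}, maximal N K /\ N <| K).
  exact: (normal_maximal_absurd Xfin alM IH bx bfix nofix maxN nN).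
have {}nmax (N : {group G}) : maximal N K -> ~~ (N <| K).
  by move=> maxN; apply/negP => nN; apply: nmax; exists N.
have [M [L [maxM maxL sNM nML maxu]]] := maximal_pair K1 nmax.
have [a0 a0U na0] := linv_not_sum (subsetIl M L) (subsetIr M L)
  (meet_proper_left maxM maxL nML) (meet_index_right maxM maxL nML sNM).
have [d [d' [Md Ld' E]]] :=
  pot_split Xfin alM IH bx bfix nofix nmax maxM maxL nML sNM maxu a0U.
exact: na0 Md Ld' E.
Qed.

Section InducedCover.
Variables (K : {group G}) (p : fin_covering X).

Definition ind_graph : graph :=
  @Graph (seg #|G| * gvert (cov_graph p)) (seg #|G| * gedge (cov_graph p))
    (fun e => (e.1, gsrc e.2)) (fun e => (e.1, gtgt e.2)).

Definition ind_map : graph_map ind_graph X.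
Proof.
exists (fun z => actv A (dec z.1) (mvert p z.2)) (fun e => acte A (dec e.1) (medge p e.2)).
- by case=> i e /=; rewrite msrc act_src.
- by case=> i e /=; rewrite mtgt act_tgt.
Defined.

Lemma ind_covering : is_covering ind_map.
Proof.
move=> e [i z]; have [cs ct] := @twist_covering G X A (dec i) p e z; split=> /= ze.
- have [e' [[E1 E2] Un]] := cs ze; exists (i, e'); split=> [|[j e''] /= [F [Ej F']]].
    by rewrite /= E2.
  by rewrite Ej in F *; rewrite (Un e'').
- have [e' [[E1 E2] Un]] := ct ze; exists (i, e'); split=> [|[j e''] /= [F [Ej F']]].
    by rewrite /= E2.
  by rewrite Ej in F *; rewrite (Un e'').
Qed.

Lemma ind_finite : is_finite_map ind_map.
Proof.
move=> v; apply: (@sub_finite_set _ _ ([set: seg #|G|] `*` [set: gvert (cov_graph p)])%classic) => //.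
by apply: finite_setX; [exact: finite_seg | exact: cov_finite_vert].
Qed.

(** The disjoint union of the twists of [p], which the group permutes. Compatibility
    of a natural isomorphism with [p] and the section follows from equivariance on it. *)
Definition ind_cover : ecover A K.
Proof.
exists (FinCovering ind_covering ind_finite)
  (fun g z => (enc (g * dec z.1), z.2)) (fun g e => (enc (g * dec e.1), e.2)) => //.
- by move=> g z _ /=; rewrite encK actvM.
- by move=> g e _ /=; rewrite encK acteM.
- by case=> i z /=; rewrite mul1g decK.
- by case=> i e /=; rewrite mul1g decK.
- by move=> g k [i z] _ _ /=; rewrite encK mulgA.
- by move=> g k [i e] _ _ /=; rewrite encK mulgA.
Defined.
End InducedCover.

(** The vertices over [v] of the power of [Z] indexed by its fiber at [x] are the maps
    from this fiber to the fiber at [v]. The section permutes the index set, and hence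
    acts on the power by conjugation; the inclusion of the fiber is a fixed point, and
    a vertex fixed by [K] is an equivariant map. *)
Section PowerCover.
Variables (K : {group G}) (Z : ecover A K).
Let I := fiber x Z.

Definition pow_graph : graph :=
  @Graph {vb : gvert X * (I -> gvert (cov_graph Z)) | forall i, mvert Z (vb.2 i) = vb.1}
    {vb : gedge X * (I -> gedge (cov_graph Z)) | forall i, medge Z (vb.2 i) = vb.1}
    (fun e => exist (fun vb : _ * _ => forall i, mvert Z (vb.2 i) = vb.1)
      (gsrc (sval e).1, fun i => gsrc ((sval e).2 i))
      (fun i => etrans (msrc Z ((sval e).2 i)) (congr1 (@gsrc X) (svalP e i))))
    (fun e => exist (fun vb : _ * _ => forall i, mvert Z (vb.2 i) = vb.1)
      (gtgt (sval e).1, fun i => gtgt ((sval e).2 i))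
      (fun i => etrans (mtgt Z ((sval e).2 i)) (congr1 (@gtgt X) (svalP e i)))).

Definition pow_map : graph_map pow_graph X :=
  @GraphMap pow_graph X (fun z => (sval z).1) (fun e => (sval e).1)
    (fun _ => erefl) (fun _ => erefl).

Lemma pow_covering : is_covering pow_map.
Proof.
move=> e [[v be] vP]; split=> /= ve; move: vP => /= vP.
- have ex i : {e' | medge Z e' = e /\ gsrc e' = be i}.
    by apply: lift_src (exist _ (be i) _); rewrite vP.
  pose ep i := sval (ex i).
  have eP i : medge Z ((e, ep).2 i) = (e, ep).1 by case: (svalP (ex i)).
  exists (exist _ (e, ep) eP); split.
    split=> //; apply: eq_exist => /=; congr pair => //.
    by apply/funext => i; case: (svalP (ex i)).
  move=> [[e2 ep2] eP2] /= [E2 [_ F2]]; apply: eq_exist; congr pair => //.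
  apply/funext => i; have [Ei Fi] := svalP (ex i).
  apply: lift_src_uniq Ei _ _; first exact: (etrans (eP2 i) E2).
  by rewrite Fi -F2.
- have ex i : {e' | medge Z e' = e /\ gtgt e' = be i}.
    by apply: lift_tgt (exist _ (be i) _); rewrite vP.
  pose ep i := sval (ex i).
  have eP i : medge Z ((e, ep).2 i) = (e, ep).1 by case: (svalP (ex i)).
  exists (exist _ (e, ep) eP); split.
    split=> //; apply: eq_exist => /=; congr pair => //.
    by apply/funext => i; case: (svalP (ex i)).
  move=> [[e2 ep2] eP2] /= [E2 [_ F2]]; apply: eq_exist; congr pair => //.
  apply/funext => i; have [Ei Fi] := svalP (ex i).
  apply: lift_tgt_uniq Ei _ _; first exact: (etrans (eP2 i) E2).
  by rewrite Fi -F2.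
Qed.

Lemma pow_finite : is_finite_map pow_map.
Proof.
move=> v; apply: (@sub_finite_set _ _ [set: gvert pow_graph]%classic) => //.
apply: finite_sig; rewrite -setXTT; apply: finite_setX; first exact: Xfin.1.
apply: finite_fun; last exact: cov_finite_vert.
by apply: finite_sig; exact: cov_finite_vert.
Qed.

(** The action of [g] on the fiber of [Z], extended to all of [G]. *)
Let Sf (g : G) (i : I) : I :=
  match pselect (mvert Z (sact al g (sval i)) = x) with
  | left e => exist _ _ e
  | right _ => i
  end.

Let SfE g i : g \in K -> sval (Sf g i) = sact al g (sval i).
Proof.
move=> Kg; rewrite /Sf; case: pselect => // -[]; apply: sact_over => //; exact: (svalP i).
Qed.

Let Sf1 i : Sf 1 i = i.
Proof. by apply: fiber_eq; rewrite SfE ?group1 // (sact1 alM) //; exact: (svalP i). Qed.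

Let SfM g k i : g \in K -> k \in K -> Sf (g * k) i = Sf g (Sf k i).
Proof.
move=> Kg Kk; apply: fiber_eq; rewrite !SfE ?groupM // (sactM alM) //.
exact: (svalP i).
Qed.

Definition pow_v (g : G) (z : gvert pow_graph) : gvert pow_graph :=
  match pselect (g \in K) with
  | left Kg => exist (fun vb : _ * _ => forall i, mvert Z (vb.2 i) = vb.1)
      (actv A g (sval z).1, fun i => eact_v g ((sval z).2 (Sf g^-1 i)))
      (fun i => etrans (eact_over _ Kg) (congr1 (actv A g) (svalP z (Sf g^-1 i))))
  | right _ => z
  end.

Definition pow_e (g : G) (e : gedge pow_graph) : gedge pow_graph :=
  match pselect (g \in K) with
  | left Kg => exist (fun vb : _ * _ => forall i, medge Z (vb.2 i) = vb.1)
      (acte A g (sval e).1, fun i => eact_e g ((sval e).2 (Sf g^-1 i)))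
      (fun i => etrans (eact_overe _ Kg) (congr1 (acte A g) (svalP e (Sf g^-1 i))))
  | right _ => e
  end.

Lemma pow_vE g z : g \in K -> sval (pow_v g z) =
  (actv A g (sval z).1, fun i => eact_v g ((sval z).2 (Sf g^-1 i))).
Proof. by rewrite /pow_v; case: pselect. Qed.

Lemma pow_eE g e : g \in K -> sval (pow_e g e) =
  (acte A g (sval e).1, fun i => eact_e g ((sval e).2 (Sf g^-1 i))).
Proof. by rewrite /pow_e; case: pselect. Qed.

Lemma pow_vert_eq (z z' : gvert pow_graph) : sval z = sval z' -> z = z'.
Proof. by case: z z' => [z zP] [z' zP'] /=; exact: eq_exist. Qed.

Lemma pow_edge_eq (e e' : gedge pow_graph) : sval e = sval e' -> e = e'.
Proof. by case: e e' => [e eP] [e' eP'] /=; exact: eq_exist. Qed.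

Definition pow_cover : ecover A K.
Proof.
exists (FinCovering pow_covering pow_finite) pow_v pow_e.
- move=> g e Kg; apply: pow_vert_eq; rewrite pow_vE //= pow_eE //= act_src.
  by congr pair; apply/funext => i; rewrite eact_src.
- move=> g e Kg; apply: pow_vert_eq; rewrite pow_vE //= pow_eE //= act_tgt.
  by congr pair; apply/funext => i; rewrite eact_tgt.
- by move=> g z Kg /=; rewrite pow_vE.
- by move=> g e Kg /=; rewrite pow_eE.
- move=> z; apply: pow_vert_eq; rewrite pow_vE ?group1 // actv1 invg1.
  case: (sval z) => v be /=; congr pair; apply/funext => i.
  by rewrite Sf1 eact_v1.
- move=> e; apply: pow_edge_eq; rewrite pow_eE ?group1 // acte1 invg1.
  case: (sval e) => v be /=; congr pair; apply/funext => i.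
  by rewrite Sf1 eact_e1.
- move=> g k z Kg Kk; apply: pow_vert_eq; rewrite !pow_vE ?groupM //= actvM.
  by congr pair; apply/funext => i; rewrite eact_vM // invMg SfM ?groupV.
- move=> g k e Kg Kk; apply: pow_edge_eq; rewrite !pow_eE ?groupM //= acteM.
  by congr pair; apply/funext => i; rewrite eact_eM // invMg SfM ?groupV.
Defined.

Definition pow_base : gvert (cov_graph pow_cover) :=
  exist (fun vb : _ * _ => forall i, mvert Z (vb.2 i) = vb.1)
    (x, fun i : I => sval i) (fun i => svalP i).

Lemma app_pow v w (a : nat_iso v w) (z : gvert (cov_graph pow_cover)) i :
  mvert pow_cover z = v -> (sval (app a z)).2 i = app a ((sval z).2 i).
Proof.
apply: (@app_nat X v w a pow_cover Z (fun z => (sval z).2 i) (fun e => (sval e).2 i)) => //.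
- by move=> y; exact: (svalP y i).
- by move=> e; exact: (svalP e i).
Qed.

Lemma pow_base_fixed g : g \in K -> sact al (Z := pow_cover) g pow_base = pow_base.
Proof.
move=> Kg; have bx : mvert pow_cover (eact_v g pow_base) = actv A g x.
  by rewrite eact_over.
apply: pow_vert_eq; rewrite [LHS]surjective_pairing; congr pair.
  exact: (app_over (al g) bx).
apply/funext => i; rewrite /sact app_pow // [eact_v g pow_base]/= pow_vE //=.
rewrite SfE ?groupV // -[app _ _]/(sact al g (sact al g^-1 (sval i))).
by rewrite -(sactM alM) ?groupV ?(svalP i) // mulgV (sact1 alM) //; exact: (svalP i).
Qed.

(** In the component of the inclusion, a fixed vertex is the image of the inclusion
    under a transport [a], so that the equivariant map it stands for is [a] itself. *)
Lemma pow_fixed :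
  (exists2 c, joined pow_base c & vfixed (Z := pow_cover) c) ->
  exists v (a : nat_iso x v), forall g z, g \in K -> mvert Z z = x ->
    app a (sact al (Z := Z) g z) = eact_v g (appc a Z z).
Proof.
move=> [c bc cfix].
have [a aE] := joined_iso bc (erefl x) (erefl (mvert pow_cover c)).
have cE i : (sval c).2 i = appc a Z (sval i).
  by have := @app_pow x _ a pow_base i erefl; rewrite aE.
exists (mvert pow_cover c), a => g z Kg zx.
pose i : I := exist _ z zx.
have := congr1 (fun z => (sval z).2 (Sf g i)) (cfix g Kg).
rewrite /= pow_vE //= -SfM ?groupV // mulVg Sf1 !cE SfE //.
Qed.
End PowerCover.

(** By induction on the order of [K] and by compactness, it suffices to treat one
    covering [p]; a fixed vertex in the power of the union of its twists gives what is
    needed. *)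
Lemma tfix_exists (K : {group G}) : exists v (a : nat_iso x v), tfix al K a.
Proof.
have [n] := ubnP #|K|; elim: n K => // n IHn K leKn.
have IH (H : {group G}) : H \proper K -> exists v (a : nat_iso x v), tfix al H a.
  by move=> pHK; apply: IHn; apply: leq_trans (proper_card pHK) _.
apply: tfix_compact => // p; pose Z := ind_cover K p.
have bx : mvert (pow_cover Z) (pow_base Z) = x by [].
have [v [a aE]] := pow_fixed (fixed_vertex IH bx (@pow_base_fixed K Z)).
exists v, a => g Kg y yx.
have zx : mvert Z (enc g^-1, y) = x by rewrite /= encK yx actvK.
have inc h u w (b : nat_iso u w) y' : mvert (twist A h p) y' = u ->
    appc b Z (enc h, y') = (enc h, appc b (twist A h p) y').
  move=> y'u; symmetry; apply: (@app_nat X u w b (twist A h p) Z (fun y => (enc h, y))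
    (fun e => (enc h, e))) => // e /=; by rewrite encK.
have inc1 u w (b : nat_iso u w) y' : mvert p y' = u ->
    appc b Z (enc 1, y') = (enc 1, appc b p y').
  by move=> y'u; rewrite inc ?app_twist1 //= actv1.
have := aE g _ Kg zx; rewrite inc; last by rewrite /= yx actvK.
rewrite /sact /= !encK mulgV inc1 // inc1; last exact: app_over yx.
by case.
Qed.
End Existence.

(** * Sections as cocycles *)

Section SectionCocycle.
Variables (Gam : groupType) (Pi : groupoid) (Act : groupoid_action Gam Pi).

(** The two sides of an equation between morphisms of the Grothendieck groupoid only
    have provably equal first components; this is the second component, read over a
    given value of the first. *)
Definition Qat x y (u : Qhom Act x y) g (e : tag u = g) : ghom (aobj Act g x) y :=
  tagged u \c eqhom (congr1 (fun s => aobj Act s x) (esym e)).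

Lemma Qat_comp x y z (u : Qhom Act y z) (w : Qhom Act x y) g k h
    (eu : tag u = g) (ew : tag w = k) (e : tag (Qcomp u w) = h)
    (E : aobj Act h x = aobj Act g (aobj Act k x)) :
  Qat e = Qat eu \c (ahom Act g (Qat ew) \c eqhom E).
Proof.
case: g / eu E; case: k / ew; case: h / e => E.
rewrite /Qat /= !gcompg1; congr (_ \c (_ \c _)); exact: eqhom_irr.
Qed.

Lemma Qat_inj x y (u w : Qhom Act x y) g (eu : tag u = g) (ew : tag w = g) :
  Qat eu = Qat ew -> u = w.
Proof.
case: g / eu ew => ew; rewrite /Qat /= gcompg1 => E.
by apply: (Qhom_eq (e := esym ew)).
Qed.

Lemma Qat_irr x y (u : Qhom Act x y) g (e e' : tag u = g) : Qat e = Qat e'.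
Proof. by congr (_ \c _); exact: eqhom_irr. Qed.

Variable x : gobj Pi.

Definition sec_coc (f : Qsection Act x) g : ghom (aobj Act g x) x := Qat (sec_split f g).

Lemma sec_cocM f g k :
  sec_coc f (g * k) = sec_coc f g \c (ahom Act g (sec_coc f k) \c eqhom (aobjM Act g k x)).
Proof.
rewrite /sec_coc; move: (sec_split f (g * k)); rewrite secM => e.
exact: Qat_comp.
Qed.

Lemma sec_coc_inj f f' : (forall g, sec_coc f g = sec_coc f' g) -> forall g, f g = f' g.
Proof. by move=> E g; exact: Qat_inj (E g). Qed.

Lemma sec_coc_conj (f f' : Qsection Act x) (c : ghom x x) : (forall g, f' g = Qker Act c \c f g \c ginv (Qker Act c)) ->
  forall g, sec_coc f' g \c ahom Act g c = c \c sec_coc f g.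
Proof.
move=> E g.
have {}E : Qcomp (f' g) (Qker Act c) = Qcomp (Qker Act c) (f g).
  change (f' g \c Qker Act c = Qker Act c \c f g).
  by rewrite E -gcompA gcompVg gcompg1.
have e1 : tag (Qcomp (f' g) (Qker Act c)) = g by rewrite /= sec_split; exact: (mulg1 g).
have e2 : tag (Qcomp (Qker Act c) (f g)) = g by rewrite /= sec_split; exact: (mul1g g).
have : Qat e1 = Qat e2.
  by move: e1 e2; rewrite E => e1 e2; exact: Qat_irr.
have k1 : tag (Qker Act c) = 1 by [].
rewrite (Qat_comp (sec_split f' g) k1 e1 (esym (congr1 (aobj Act g) (aobj1 Act x)))).
rewrite (Qat_comp k1 (sec_split f g) e2 (esym (aobj1 Act _))).
rewrite -/(sec_coc f' g) -/(sec_coc f g).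
have -> : Qat k1 = c \c eqhom (aobj1 Act x).
  by rewrite (Qat_irr k1 erefl) /Qat /= gcompg1.
rewrite ahom_comp ahom_eqhom -!gcompA !eqhom_comp eqhom_id gcompg1 => ->.
by rewrite (eqhom_ahom1 Act erefl) -!gcompA eqhomK eqhom_comp eqhom_id gcompg1.
Qed.

Lemma sec_coc_fixed y (fy : is_fixed Act y) (phi : ghom x y) g :
  phi \c sec_coc (fixed_sec fy phi) g = eqhom (fy g) \c ahom Act g phi.
Proof.
rewrite /sec_coc (Qat_irr (sec_split (fixed_sec fy phi) g) erefl) /Qat /= gcompg1.
by rewrite gcompVK.
Qed.

Lemma sec_fixed_eq f y (fy : is_fixed Act y) (phi : ghom x y) :
  (forall g, phi \c sec_coc f g = eqhom (fy g) \c ahom Act g phi) ->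
  sec_conj (fixed_sec fy phi) f.
Proof.
move=> E.
have fE : forall g, f g = fixed_sec fy phi g.
  by apply: sec_coc_inj => g; apply: (gcompI (a := phi)); rewrite E sec_coc_fixed.
have [c cE] := sec_conj_refl (fixed_sec fy phi).
by exists c => g; rewrite fE.
Qed.
End SectionCocycle.

(** * Sections of fixed vertices *)

Section SectionsOfGraph.
Variables (X : graph) (G : finGroupType) (A : graph_action G X) (x : gvert X).
Let Act := Pi1_action A.
Implicit Types f : Qsection Act x.

Definition sec_iso f g : nat_iso (actv A g x) x := sec_coc f g.

Lemma sec_isoM f g k p (y : gvert (cov_graph p)) : mvert p y = actv A (g * k) x ->
  appc (sec_iso f (g * k)) p y =
  appc (sec_iso f g) p (appc (sec_iso f k) (twist A g^-1 p) y).
Proof.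
move=> yx; have yx' : mvert p y = actv A g (actv A k x) by rewrite yx actvM.
pose e : nat_iso (actv A (g * k) x) (actv A g (actv A k x)) := eqhom (aobjM Act g k x).
have -> : sec_iso f (g * k)
    = nat_iso_comp (sec_iso f g) (nat_iso_comp (act_nat_iso A g (sec_iso f k)) e).
  exact: (@sec_cocM G (Pi1 X) Act x f g k).
have ey : appc e p y = y by exact: app_eqhom.
by rewrite app_comp // app_comp // ey app_act.
Qed.

(** The section defined by [a] is given by [a^-1] after [g(a)].  So a vertex [a] of the
    universal pro-finite covering over a fixed vertex of [X] is fixed if and only if the
    given section is the one defined by [a]. *)
Lemma tfix_secP f v (a : nat_iso x v) (fv : is_fixed Act v) :
  tfix (sec_iso f) [set: G] a <->
  (forall g, (a : ghom (x : gobj (Pi1 X)) v) \c sec_coc f g = eqhom (fv g) \c ahom Act g a).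
Proof.
have L g p (y : gvert (cov_graph p)) : mvert p y = actv A g x ->
    appc ((a : ghom (x : gobj (Pi1 X)) v) \c sec_coc f g : nat_iso _ _) p y
    = appc a p (appc (sec_iso f g) p y).
  by move=> yx; exact: (app_comp a (sec_iso f g) yx).
have R g p (y : gvert (cov_graph p)) : mvert p y = actv A g x ->
    appc (eqhom (fv g) \c ahom Act g a : nat_iso _ _) p y = appc a (twist A g^-1 p) y.
  move=> yx; have -> := app_comp (eqhom (fv g) : nat_iso _ _) (act_nat_iso A g a) yx.
  by rewrite app_eqhom; [exact: app_act | exact: (app_over (act_nat_iso A g a) yx)].
split=> [aK g|E g _ p y yx]; last by rewrite -L // E R.
by apply: nat_iso_app => p y yx; rewrite L // R // aK ?inE.
Qed.

(** The graph [X] itself as an equivariant covering, in which fixed vertices of the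
    universal pro-finite covering have fixed images. *)
Definition id_cover K : ecover A K.
Proof.
exists (id_cov X) (actv A) (acte A) => //=.
- by move=> g e _; exact: act_src.
- by move=> g e _; exact: act_tgt.
- exact: actv1.
- exact: acte1.
- by move=> g k z _ _; exact: actvM.
- by move=> g k e _ _; exact: acteM.
Defined.

Lemma tfix_fixed f v (a : nat_iso x v) : tfix (sec_iso f) [set: G] a -> is_fixed Act v.
Proof.
move=> aK g; have yx : mvert (id_cover [set: G]) (actv A g x) = actv A g x by [].
have yx' : mvert (twist A g^-1 (id_cover [set: G])) (actv A g x) = x by rewrite /= actvK.
have E := aK g (in_setT g) (id_cover [set: G]) _ yx.
have Ev : appc a (id_cover [set: G]) (appc (sec_iso f g) (id_cover [set: G]) (actv A g x)) = v.
  exact: (app_over a (app_over (sec_iso f g) yx)).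
have /(congr1 (actv A g)) := app_over a yx'.
by rewrite /= actvKV -E Ev.
Qed.

Lemma fjoined_fixed_graph v w (fv : is_fixed Act v) (fw : is_fixed Act w) :
  fjoined (Z := id_cover [set: G]) v w ->
  joined (exist _ v fv : gvert (fixed_graph A)) (exist _ w fw).
Proof.
move=> j; elim: j fv fw => {v w}.
- move=> v w [e [fe <- <-]] fv fw; apply: rst_step.
  have fe' g : acte A g e = e by apply: fe; rewrite inE.
  by exists (exist _ e fe'); split; apply: eq_exist.
- by move=> v fv fw; rewrite (Prop_irrelevance fv fw); exact: rst_refl.
- by move=> v w _ IH fv fw; apply/rst_sym/IH.
- move=> v u w h1 IH1 h2 IH2 fv fw.
  have fu : is_fixed Act u.
    by move=> g; apply: ((fjoined_vfixed h1).1 _ g (in_setT g)) => k _; exact: fv.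
  exact: rst_trans (IH1 fv fu) (IH2 fu fw).
Qed.

(** A fixed edge of [X] has a lift that starts at [a]; this lift is unique, hence
    fixed. *)
Lemma edge_iso_fixed (e : fixed_edge A) f (a : nat_iso x (gsrc (sval e))) :
  tfix (sec_iso f) [set: G] a ->
  exists b : nat_iso x (gtgt (sval e)), tfix (sec_iso f) [set: G] b.
Proof.
case: e a => e fe /= a aK; have [c cE] := edge_iso e.
exists (nat_iso_comp c a) => g Kg p y yx.
have yx' : mvert (twist A g^-1 p) y = x by rewrite /= yx actvK.
rewrite (app_comp c a (app_over (sec_iso f g) yx)) (app_comp c a yx').
rewrite aK //; set w := appc a (twist A g^-1 p) y.
have wx : mvert p w = gsrc e.
  have wE : actv A g^-1 (mvert p w) = gsrc e := app_over a yx'.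
  by move/(congr1 (actv A g)): wE; rewrite actvKV act_src fe.
have [e' [e'e /= e'w]] := lift_src (exist (fun z => mvert p z = gsrc e) w wx).
rewrite -e'w cE //; symmetry; apply: (cE (twist A g^-1 p)).
by rewrite /= e'e fe.
Qed.
End SectionsOfGraph.

Lemma eq_class_surj (T : Type) (R : T -> T -> Prop) (C : eq_quotient R) :
  exists a, eq_class R a = C.
Proof. by case: C => C [a aE]; exists a; exact: eq_exist. Qed.

(** * The bijection *)

Section Classes.
Variables (X : graph) (Xfin : finite_graph X) (Xconn : connected_graph X).
Variables (G : finGroupType) (A : graph_action G X) (x : gvert X).
Let Act := Pi1_action A.

Lemma hmap_class f (y : gvert (fixed_graph A)) (a : nat_iso x (sval y)) :
  tfix (sec_iso f) [set: G] a -> hmap Xconn x y = eq_class (@sec_conj _ _ Act x) f.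
Proof.
move=> aK; rewrite /hmap (sec_classE (Pi1_connected Xconn) (svalP y : is_fixed Act (sval y)) (a : @ghom (Pi1 X) x (sval y))).
apply/eq_classE; [exact: sec_conj_refl|exact: sec_conj_sym|exact: sec_conj_trans|].
by apply: sec_fixed_eq; apply/tfix_secP.
Qed.

Lemma tfix_fixed_sec (y : gvert (fixed_graph A)) (a : nat_iso x (sval y)) :
  tfix (sec_iso (fixed_sec (svalP y : is_fixed Act _) (a : @ghom (Pi1 X) x _))) [set: G] a.
Proof.
apply/(tfix_secP _ _ (svalP y : is_fixed Act (sval y))) => g.
exact: (@sec_coc_fixed G (Pi1 X) Act x (sval y) (svalP y) a g).
Qed.

Lemma hmap_surj (c : Sec Act x) : exists y : gvert (fixed_graph A), hmap Xconn x y = c.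
Proof.
have [f <-] := eq_class_surj c.
have [v [a aK]] := tfix_exists Xfin (@sec_isoM _ _ _ _ f) [set: G]%G.
exists (exist _ v (tfix_fixed aK)).
exact: (@hmap_class f (exist _ v (tfix_fixed aK)) a aK).
Qed.

(** Running along a fixed edge leads from a vertex that defines a section to another
    one. *)
Lemma hmap_joined (y y' : gvert (fixed_graph A)) :
  joined y y' -> hmap Xconn x y = hmap Xconn x y'.
Proof.
elim=> {y y'} [y y' [e [<- <-]]|y|y y' _ ->|y u y' _ -> _ ->] //.
have [a] := Pi1_connected Xconn x (sval (gsrc e)).
have aK := tfix_fixed_sec (y := gsrc e) a.
have [b bK] := edge_iso_fixed aK.
by rewrite (hmap_class aK) (hmap_class (y := gtgt e) bK).
Qed.

(** If two fixed vertices define conjugate sections, then one section is defined by two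
    vertices of the universal pro-finite covering, to which [fixed_joined] applies. *)
Lemma hmap_inj (y y' : gvert (fixed_graph A)) :
  hmap Xconn x y = hmap Xconn x y' -> joined y y'.
Proof.
have [a] := Pi1_connected Xconn x (sval y).
have [a'] := Pi1_connected Xconn x (sval y').
have aK := tfix_fixed_sec (y := y) a.
have a'K := tfix_fixed_sec (y := y') a'.
rewrite (hmap_class aK) (hmap_class a'K).
move/(eq_classE (@sec_conj_refl _ _ Act x) (@sec_conj_sym _ _ Act x)
  (@sec_conj_trans _ _ Act x)) => [c cE].
set f := fixed_sec _ _ in aK cE; set f' := fixed_sec _ _ in a'K cE.
have a'cK : tfix (sec_iso f) [set: G] (nat_iso_comp a' c).
  apply/(tfix_secP f (nat_iso_comp a' c) (svalP y')) => g.
  have E := sec_coc_conj cE g.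
  have E' := (tfix_secP f' a' (svalP y')).1 a'K g.
  change ((a' : @ghom (Pi1 X) x _) \c c \c sec_coc f g
    = eqhom (svalP y' g : aobj Act g _ = _) \c ahom Act g ((a' : @ghom (Pi1 X) x _) \c c)).
  by rewrite -gcompA -E gcompA E' ahom_comp gcompA.
have xx : mvert (id_cover A [set: G]) x = x by [].
have xfix g : g \in [set: G] -> sact (sec_iso f) (Z := id_cover A [set: G]) g x = x.
  move=> _; exact: (app_over (sec_iso f g) (erefl : mvert (id_cover A [set: G]) (actv A g x) = _)).
have := fixed_joined (K := [set: G]%G) (Z := id_cover A [set: G]) Xfin aK a'cK xx xfix.
have -> : appc a (id_cover A [set: G]) x = sval y by exact: (app_over a xx).
have -> : appc (nat_iso_comp a' c) (id_cover A [set: G]) x = sval y'.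
  exact: (app_over (nat_iso_comp a' c) xx).
move/(fjoined_fixed_graph (svalP y) (svalP y')).
have eta (u : {v | is_fixed Act v}) : exist _ (sval u) (svalP u) = u.
  by case: u => v fv; exact: eq_exist.
by move=> j; rewrite -(eta y) -(eta y').
Qed.
End Classes.

Theorem theorem3p7 (X : graph) (Xfin : finite_graph X)
    (Xconn : connected_graph X) (G : finGroupType) (A : graph_action G X)
    (x : gvert X) :
  (forall c : Sec (Pi1_action A) x,
     exists y : gvert (fixed_graph A), hmap Xconn x y = c) /\
  (exists hbar : pi0 (fixed_graph A) -> Sec (Pi1_action A) x,
     (forall y : gvert (fixed_graph A),
        hbar (component y) = hmap Xconn x y) /\
     bijective hbar).
Proof.
split; first exact: hmap_surj.
have compE (y y' : gvert (fixed_graph A)) : component y = component y' <-> joined y y'.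
  by apply: eq_classE => [u|u v|u v w]; [exact: rst_refl|exact: rst_sym|exact: rst_trans].
have [lift liftK] := choice (@eq_class_surj _ (@joined (fixed_graph A))).
have [pt ptK] := choice (@hmap_surj X Xfin Xconn G A x).
exists (fun C => hmap Xconn x (lift C)); split=> [y|].
  by apply/hmap_joined/compE; exact: liftK.
exists (fun c => component (pt c)) => [C|c].
  by rewrite -[RHS]liftK; apply/compE/hmap_inj => //; exact: ptK.
by rewrite -[RHS]ptK; apply/hmap_joined/compE; exact: liftK.
Qed.
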